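(* Let $\Sigma\succ0$, let $\pi_\mu(u)=\mathcal{N}(u;\mu,\Sigma)$ be the fixed-covariance Gaussian family with mean $\mu\in\mathbb{R}^m$, and let $F$, $\rho_\mu$, $w$, $D_{\Sigma^{-1}}$, $D$, $L_\Sigma$ be as in the context. Consider the exact MPPI iteration (unit step size $\eta=1$) $$\mu_{k+1}=\mathbb{E}_{\rho_{\mu_k}}[u]=\frac{\mathbb{E}_{\pi_{\mu_k}}[w(u)u]}{\mathbb{E}_{\pi_{\mu_k}}[w(u)]}.$$ Whenever the unit step size is admissible, i.e. $0<1<\frac{2}{L_\Sigma}$, equivalently $L_\Sigma<2$, this iteration satisfies, with $P:=\frac1\tau\Sigma$: 1. for every $k$, $F(\mu_{k+1})\le F(\mu_k)-\big(1-\frac{L_\Sigma}{2}\big)\|\nabla F(\mu_k)\|_P^2$; 2. $\displaystyle\sum_{k=0}^\infty\|\nabla F(\mu_k)\|_P^2\le\frac{F(\mu_0)-\inf_{\mu}F(\mu)}{1-\frac{L_\Sigma}{2}}$; 3. for every $K\ge1$, $\displaystyle\min_{0\le j\le K-1}\|\nabla F(\mu_j)\|_P^2\le\frac{F(\mu_0)-\inf_{\mu}F(\mu)}{K\big(1-\frac{L_\Sigma}{2}\big)}$, and in particular $\lim_{k\to\infty}\|\nabla F(\mu_k)\|_P=0$. Using the bound $L_\Sigma\le\max\{1,\frac{D_{\Sigma^{-1}}^2}{4}-1\}$, a sufficient condition for $L_\Sigma<2$ (and hence for these conclusions) is $D_{\Sigma^{-1}}^2<12$. Since $D_{\Sigma^{-1}}^2\le\frac{D^2}{\lambda_{\min}(\Sigma)}$,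 this condition is guaranteed when $\lambda_{\min}(\Sigma)\ge\frac{D^2}{12}$.
   Context: $C\subset\mathbb{R}^m$ is a nonempty compact (in particular bounded) set of feasible control sequences, $f_0$ is a continuous real-valued objective, and $\tau>0$. $\mathcal{N}(u;\mu,\Sigma)$ is the Gaussian density with mean $\mu$ and covariance $\Sigma$; the mean $\mu\in\mathbb{R}^m$ is the optimization variable, and the suprema and infima over $\mu$ are over its parameter set. Define $$w(u):=\exp(-f_0(u)/\tau)\mathbf{1}_C(u),\quad Z(\mu):=\int_C\pi_\mu(u)e^{-f_0(u)/\tau}\,du,\quad F(\mu):=-\tau\log Z(\mu),\quad\rho_\mu(u):=\frac{\pi_\mu(u)w(u)}{Z(\mu)},$$ where $Z(\mu)>0$ since $\pi_\mu$ is positive on $C$, and $$D_{\Sigma^{-1}}:=\sup_{u,v\in C}\|\Sigma^{-1/2}(u-v)\|,\quad D:=\sup_{u,v\in C}\|u-v\|,\quad L_\Sigma:=\sup_{\mu}\left\|I-\Sigma^{-1/2}\operatorname{Cov}_{\rho_\mu}(u)\Sigma^{-1/2}\right\|.$$ Notation: $\mathbf{1}_C$ is the indicator function of $C$; $\|\cdot\|$ is the Euclidean norm for vectors and the spectral norm for matrices; $\|x\|_P^2:=x^\top Px$; $\lambda_{\min}$ is the smallest eigenvalue; $\mathbb{E}_\rho$ and $\operatorname{Cov}_\rho$ are the expectation and covariance under $\rho$.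
   Formalization: The last sentence fails at equality (m=1, C=[0,D], Σ=D²/12 gives D_{Σ^{-1}}²=12): λ_min > D²/12 is shown to give D_{Σ^{-1}}² < 12, and λ_min ≥ D²/12 only ≤ 12. Also C is assumed of positive Lebesgue measure, so that Z(μ)>0, and m ≥ 1. *)

(* Defs.v *)
From HB Require Import structures.
From mathcomp Require Import all_boot all_order all_algebra.
From mathcomp Require Import all_classical all_reals all_analysis.

Set Implicit Arguments.
Unset Strict Implicit.
Unset Printing Implicit Defensive.

Import Order.TTheory GRing.Theory Num.Theory.
Import numFieldNormedType.Exports.

Local Open Scope classical_set_scope.
Local Open Scope ring_scope.

Section measurable_cV.
Context d (T : sigmaRingType d) (n : nat).

Let coor : 'I_n -> 'cV[T]_n -> T := fun i u => u i ord0.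

Let cV_set0 : g_sigma_preimage coor set0.
Proof. exact: sigma_algebra0. Qed.

Let cV_setC A : g_sigma_preimage coor A -> g_sigma_preimage coor (~` A).
Proof. exact: sigma_algebraC. Qed.

Let cV_bigcup (F : _^nat) : (forall i, g_sigma_preimage coor (F i)) ->
  g_sigma_preimage coor (\bigcup_i (F i)).
Proof. exact: sigma_algebra_bigcup. Qed.

(* The product sigma-algebra, generated by the coordinates as for n.-tuple; for
   T = R this is the Borel sigma-algebra of R^n. *)
HB.instance Definition _ := @isMeasurable.Build (measure_tuple_display d)
  'cV[T]_n (g_sigma_preimage coor) cV_set0 cV_setC cV_bigcup.

End measurable_cV.

Lemma measurable_coor d (T : measurableType d) n (i : 'I_n) :
  measurable_fun [set: 'cV[T]_n] (fun u => u i ord0).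
Proof.
move=> _ Y mY; rewrite setTI; apply: sub_sigma_algebra => /=.
case: n i => [[] []//|n] i.
rewrite -bigcup_mkord_ord; exists i; first exact: ltn_ord.
by exists Y => //; rewrite setTI inord_val.
Qed.

Lemma measurable_fun_coorP d1 d2 (T1 : measurableType d1)
    (T2 : measurableType d2) n (f : T1 -> 'cV[T2]_n) :
  measurable_fun [set: T1] f <->
  forall i, measurable_fun [set: T1] (fun x => f x i ord0).
Proof.
split=> [mf i|mf].
  exact: (measurableT_comp (measurable_coor i) mf).
suff : g_sigma_preimage (fun i x => f x i ord0) `<=` measurable.
  move=> sub _ A mA; rewrite setTI; apply: sub.
  rewrite (_ : (fun i x => f x i ord0) =
     (fun i : 'I_n => (fun u : 'cV_n => u i ord0) \o f)) //.
  by rewrite g_sigma_preimage_comp; exists A => //; rewrite setTI.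
apply: smallest_sub; first exact: sigma_algebra_measurable.
case: n => [|n] in f mf *; first by rewrite big_ord0.
rewrite -bigcup_mkord_ord; apply: bigcup_sub => i Ii.
by move=> A [B mB <-]; exact: mf.
Qed.

Section lebesgue_cV_step.
Context {R : realType} (n : nat).
Variable mu : {sigma_finite_measure set 'cV[R]_n -> \bar R}.

Definition cons_cV (p : measurableTypeR R * 'cV[R]_n) : 'cV[R]_n.+1 :=
  \col_i oapp (fun j => p.2 j ord0) p.1 (unlift ord0 i).

Lemma measurable_cons_cV : measurable_fun setT cons_cV.
Proof.
apply/measurable_fun_coorP => i.
under eq_fun do rewrite mxE.
case: (unlift ord0 i) => [j|] /=; last exact: measurable_fst.
exact: (measurableT_comp (measurable_coor j) measurable_snd).
Qed.

Definition uncons_cV (u : 'cV[R]_n.+1) : measurableTypeR R * 'cV[R]_n :=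
  (u ord0 ord0, \col_j u (lift ord0 j) ord0).

Lemma measurable_uncons_cV : measurable_fun setT uncons_cV.
Proof.
apply: measurable_fun_pair => /=; first exact: measurable_coor.
apply/measurable_fun_coorP => i.
by under eq_fun do rewrite mxE; exact: measurable_coor.
Qed.

Lemma cons_cVK : cancel cons_cV uncons_cV.
Proof.
move=> [x v]; rewrite /uncons_cV mxE unlift_none /=; congr pair.
by apply/colP => j; rewrite !mxE liftK.
Qed.

(* The image of lambda_1 x mu under R * R^n = R^{n+1}. *)
Definition lebesgue_cons : set 'cV[R]_n.+1 -> \bar R :=
  pushforward ((@lebesgue_measure R) \x mu)%E cons_cV.

Let preimage_cons_cV A : measurable A -> measurable (cons_cV @^-1` A).
Proof.
by move=> mA; rewrite -[X in measurable X]setTI; exact: measurable_cons_cV.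
Qed.

Let lebesgue_cons0 : lebesgue_cons set0 = 0%E.
Proof. by rewrite /lebesgue_cons /pushforward preimage_set0 measure0. Qed.

Let lebesgue_cons_ge0 A : (0 <= lebesgue_cons A)%E.
Proof. by rewrite /lebesgue_cons /pushforward measure_ge0. Qed.

Let lebesgue_cons_sigma_additive : semi_sigma_additive lebesgue_cons.
Proof.
move=> F mF tF mUF; rewrite /lebesgue_cons /pushforward preimage_bigcup.
apply: measure_semi_sigma_additive.
- by move=> k; exact: preimage_cons_cV.
- apply/trivIsetP => /= i j _ _ ij; rewrite -preimage_setI.
  by move/trivIsetP : tF => /(_ _ _ _ _ ij) ->//; rewrite preimage_set0.
- by rewrite -preimage_bigcup; exact: preimage_cons_cV.
Qed.

HB.instance Definition _ := isMeasure.Build _ _ _ lebesgue_cons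
  lebesgue_cons0 lebesgue_cons_ge0 lebesgue_cons_sigma_additive.

Let lebesgue_cons_sigma_finite : sigma_finite setT lebesgue_cons.
Proof.
have /sigma_finiteP[F [TF ndF Foo]] := sigma_finiteT (@lebesgue_measure R).
have /sigma_finiteP[G [TG ndG Goo]] := sigma_finiteT mu.
exists (fun k => uncons_cV @^-1` (F k `*` G k)).
  apply/esym; rewrite -subTset => u _.
  have [i _ Fi] : (\bigcup_k F k) (uncons_cV u).1 by rewrite -TF.
  have [j _ Gj] : (\bigcup_k G k) (uncons_cV u).2 by rewrite -TG.
  exists (maxn i j) => //; split.
    by move: Fi; exact/subsetPset/ndF/leq_maxl.
  by move: Gj; exact/subsetPset/ndG/leq_maxr.
move=> k; have [mF ltF] := Foo k; have [mG ltG] := Goo k; split.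
  rewrite -[X in measurable X]setTI; apply: measurable_uncons_cV => //.
  exact: measurableX.
rewrite /lebesgue_cons /pushforward -comp_preimage.
rewrite (_ : uncons_cV \o cons_cV = id); last first.
  by apply/funext => p; exact: cons_cVK.
by rewrite preimage_id product_measure1E// lte_mul_pinfty// ge0_fin_numE.
Qed.

HB.instance Definition _ := Measure_isSigmaFinite.Build _ _ _ lebesgue_cons
  lebesgue_cons_sigma_finite.

End lebesgue_cV_step.

Fixpoint lebesgue_cV {R : realType} n :
    {sigma_finite_measure set 'cV[R]_n -> \bar R} :=
  if n is n'.+1 then lebesgue_cons (lebesgue_cV n') else \d_ (0 : 'cV[R]_0).

(* The normalization lambda(prod_i [a_i, b_i]) = prod_i (b_i - a_i), which
   characterizes Lebesgue measure. *)
Lemma lebesgue_cV_box {R : realType} n (a b : 'cV[R]_n) :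
  (forall i, a i ord0 <= b i ord0) ->
  lebesgue_cV n [set u | forall i, a i ord0 <= u i ord0 <= b i ord0] =
  (\prod_i (b i ord0 - a i ord0))%:E.
Proof.
elim: n a b => [|n IHn] a b ab /=.
  rewrite big_ord0 diracE mem_set//= => -[] //.
rewrite /lebesgue_cons /pushforward.
set B := [set v : 'cV[R]_n | forall i,
  a (lift ord0 i) ord0 <= v i ord0 <= b (lift ord0 i) ord0].
have -> : @cons_cV R n @^-1` [set u | forall i, a i ord0 <= u i ord0 <= b i ord0] =
    `[a ord0 ord0, b ord0 ord0]%classic `*` B.
  apply/seteqP; split => -[x v] /=.
    move=> H; split; first by rewrite in_itv /=; have := H ord0; rewrite mxE unlift_none.
    by move=> i; have := H (lift ord0 i); rewrite mxE liftK.
  move=> [] /=; rewrite in_itv /= => x01 vB i.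
  rewrite mxE; case: unliftP => [j ->|->] //=; exact: vB.
have mB : measurable B.
  rewrite (_ : B = \bigcap_(i in [set: 'I_n]) ((fun v : 'cV[R]_n => v i ord0) @^-1`
      `[a (lift ord0 i) ord0, b (lift ord0 i) ord0]%classic)); last first.
    apply/seteqP; split => v /= vB i.
      by move=> _; rewrite /= in_itv /=; exact: vB.
    by have := vB i I; rewrite /= in_itv.
  apply: (fin_bigcap_measurable (@finite_finset _ [set: 'I_n])).
  move=> i _; rewrite -[X in measurable X]setTI; exact: measurable_coor.
rewrite product_measure1E //=.
rewrite lebesgue_measure_itv /= lte_fin.
have -> : lebesgue_cV n B =
    (\prod_i (b (lift ord0 i) ord0 - a (lift ord0 i) ord0))%:E.
  have -> : B = [set u | forall i, (\col_j a (lift ord0 j) ord0) i ord0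
      <= u i ord0 <= (\col_j b (lift ord0 j) ord0) i ord0].
    by apply/seteqP; split => v /= vB i; have := vB i; rewrite !mxE.
  rewrite IHn; last by move=> i; rewrite !mxE.
  by congr EFin; apply: eq_bigr => i _; rewrite !mxE.
rewrite big_ord_recl /= EFinM; congr (_ * _)%E.
have := ab ord0; rewrite le_eqVlt => /orP[/eqP->|->]; last by rewrite EFinB.
by rewrite ltxx subrr.
Qed.

Section euclidean.
Context {R : realType} {m : nat}.
Implicit Types (x : 'cV[R]_m) (A P S : 'M[R]_m).

(* The library's norm `|x| on 'cV[R]_m is the sup norm; it is only used here
   through the topology it induces. *)
Definition norm2 x : R := Num.sqrt (\sum_i x i ord0 ^+ 2).

(* ||x||_P^2 = x^T P x *)
Definition sqnorm P x : R := (x^T *m P *m x) ord0 ord0.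

(* Operator norm of A for the Euclidean norm. *)
Definition spectral_norm A : R :=
  sup [set norm2 (A *m x) | x in [set x | norm2 x <= 1]].

Definition posdef A : Prop :=
  A^T = A /\ forall x, x != 0 -> 0 < sqnorm A x.

(* S^{-1/2}: the unique positive definite square root of S^{-1} (for S positive
   definite). *)
Definition invsqrtmx S : 'M[R]_m :=
  xget 0 [set A | posdef A /\ A *m A = invmx S].

(* For symmetric A and m > 0 the set of eigenvalues is finite and nonempty, so
   that this infimum is a minimum. *)
Definition lambda_min A : R := inf [set a | eigenvalue A a].

Definition gradient (f : 'cV[R]_m -> R) x : 'cV[R]_m :=
  \col_i 'D_(delta_mx i ord0) f x.

End euclidean.

Section mppi.
Context {R : realType} {m : nat}.
Implicit Types (u mu : 'cV[R]_m) (p : 'cV[R]_m -> R) (C : set 'cV[R]_m)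
  (tau : R) (Sigma : 'M[R]_m).

(* Entrywise E_p[g(u)], for u distributed with Lebesgue density p. *)
Definition expect p {a b : nat} (g : 'cV[R]_m -> 'M[R]_(a, b)) : 'M[R]_(a, b) :=
  \matrix_(i, j) \int[lebesgue_cV m]_u (p u * g u i j).

Definition mean p : 'cV[R]_m := expect p id.

Definition covariance_mx p : 'M[R]_m :=
  expect p (fun u => (u - mean p) *m (u - mean p)^T).

Definition gaussian_pdf Sigma mu u : R :=
  (Num.sqrt ((2 * pi) ^+ m * \det Sigma))^-1 *
  expR (- (sqnorm (invmx Sigma) (u - mu) / 2)).

Definition weight C (f0 : 'cV[R]_m -> R) tau u : R :=
  expR (- f0 u / tau) * \1_C u.

Definition partition_fun C (f0 : 'cV[R]_m -> R) tau Sigma mu : R :=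
  \int[lebesgue_cV m]_(u in C) (gaussian_pdf Sigma mu u * expR (- f0 u / tau)).

Definition free_energy C (f0 : 'cV[R]_m -> R) tau Sigma mu : R :=
  - tau * ln (partition_fun C f0 tau Sigma mu).

Definition tilted C (f0 : 'cV[R]_m -> R) tau Sigma mu u : R :=
  gaussian_pdf Sigma mu u * weight C f0 tau u / partition_fun C f0 tau Sigma mu.

Definition diam C : R := sup [set norm2 (u - v) | u in C & v in C].

(* D_{Sigma^{-1}} *)
Definition diam_inv Sigma C : R :=
  sup [set norm2 (invsqrtmx Sigma *m (u - v)) | u in C & v in C].

(* L_Sigma. Like the two diameters above, this is the supremum of a nonempty
   bounded set when C is compact and nonempty. *)
Definition smoothness C (f0 : 'cV[R]_m -> R) tau Sigma : R :=
  let W := invsqrtmx Sigma in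
  sup [set spectral_norm
         (1%:M - W *m covariance_mx (tilted C f0 tau Sigma mu) *m W)
      | mu in [set: 'cV[R]_m]].

End mppi.

(* Main.v *)
Require Import Defs.
From HB Require Import structures.
From mathcomp Require Import all_boot all_order all_algebra.
From mathcomp Require Import all_classical all_reals all_analysis.
From mathcomp Require Import measurable_realfun ring lra.
Set Implicit Arguments.
Unset Strict Implicit.
Unset Printing Implicit Defensive.
Import Order.TTheory GRing.Theory Num.Theory.
Import numFieldNormedType.Exports.
Local Open Scope classical_set_scope.
Local Open Scope ring_scope.

(** Completing the square in the Gaussian exponent turns the partition function
on a line into an exponential integral. With p = Sigma^-1 h, H = h^T p and
a(u) = p^T (u - mu),
  Z(mu + t h) = exp(- t^2 H / 2) * int_C exp(t a(u)) pi_mu(u) e^{-f0(u)/tau} du.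
As a is bounded on the compact set C, this can be differentiated twice under the
integral sign, and phi(t) = F(mu + t h) satisfies
  phi'(t)  = tau (t H - E_t[a]),    phi''(t) = tau (H - Var_t[a]),
where E_t and Var_t refer to rho at mu + t h ([free_energy_line_derive],
[mean_line_derive]). The first formula gives grad F(mu) = tau Sigma^-1 (mu -
E_rho[u]) ([gradient_free_energy]): the MPPI update is the unit step of gradient
descent preconditioned by P = Sigma / tau. In the second one, H - Var_t[a] is the
quadratic form of I - W Cov W at W h, where W = Sigma^{-1/2}, so it is at most
L H ([smoothness_curvature]). For h = mu_{k+1} - mu_k one has E_0[a] = H and
tau H = ||grad F(mu_k)||_P^2, and Taylor's inequality on [0, 1] is exactly the
descent inequality ([mppi_descent]). Summing it, with F bounded below because the
Gaussian density is bounded, gives the three convergence claims.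

The equivalence between 1 < 2 / L and L < 2 requires L > 0. In fact L >= 1
([smoothness_ge1]): E_t[a] stays bounded since a is bounded on C, whereas L < 1
would force its derivative Var_t[a] to be at least (1 - L) H > 0.

The bound on L is Popoviciu's inequality ([popoviciu]): for a vector x the random
variable (W x)^T u ranges over an interval of length at most |x| D_{Sigma^-1}, so
its variance is at most |x|^2 D_{Sigma^-1}^2 / 4, and the spectral norm of the
symmetric matrix I - W Cov W is the largest absolute value of its quadratic form
on the unit sphere.
The linear algebra rests on one fact, that a symmetric matrix has an eigenvector
maximizing its quadratic form on the sphere ([rayleigh_max]): it yields the
square root W, by deflation, and the bound of the quadratic form of Sigma from
below by lambda_min. *)

(** * Euclidean geometry and symmetric matrices *)

Section dot_product.
Context {R : realType} {n : nat}.
Implicit Types (x y z : 'cV[R]_n) (A S : 'M[R]_n).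

Definition dot x y : R := (x^T *m y) ord0 ord0.

Lemma dotE x y : dot x y = \sum_i x i ord0 * y i ord0.
Proof. by rewrite /dot mxE; apply: eq_bigr => i _; rewrite mxE. Qed.

Lemma dotC x y : dot x y = dot y x.
Proof. by rewrite !dotE; apply: eq_bigr => i _; rewrite mulrC. Qed.

Lemma dotDr x y z : dot x (y + z) = dot x y + dot x z.
Proof. by rewrite /dot mulmxDr mxE. Qed.

Lemma dotDl x y z : dot (y + z) x = dot y x + dot z x.
Proof. by rewrite !(dotC _ x) dotDr. Qed.

Lemma dotZr a x y : dot x (a *: y) = a * dot x y.
Proof. by rewrite /dot -scalemxAr mxE. Qed.

Lemma dotZl a x y : dot (a *: x) y = a * dot x y.
Proof. by rewrite dotC dotZr dotC. Qed.

Lemma dotNr x y : dot x (- y) = - dot x y.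
Proof. by rewrite -scaleN1r dotZr mulN1r. Qed.

Lemma dotNl x y : dot (- x) y = - dot x y.
Proof. by rewrite dotC dotNr dotC. Qed.

Lemma dotBr x y z : dot x (y - z) = dot x y - dot x z.
Proof. by rewrite dotDr dotNr. Qed.

Lemma dotBl x y z : dot (y - z) x = dot y x - dot z x.
Proof. by rewrite !(dotC _ x) dotBr. Qed.

Lemma dot0r x : dot x 0 = 0.
Proof. by rewrite -[0 in LHS](scale0r x) dotZr mul0r. Qed.

Lemma dot_mulmx A x y : dot x (A *m y) = dot (A^T *m x) y.
Proof. by rewrite /dot trmx_mul trmxK mulmxA. Qed.

Lemma sqnormE A x : sqnorm A x = dot x (A *m x).
Proof. by rewrite /sqnorm /dot mulmxA. Qed.

Lemma dot_ge0 x : 0 <= dot x x.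
Proof. by rewrite dotE; apply: sumr_ge0 => i _; rewrite -expr2 sqr_ge0. Qed.

Lemma dot_eq0 x : (dot x x == 0) = (x == 0).
Proof.
apply/eqP/eqP => [|->]; last exact: dot0r.
rewrite dotE => /psumr_eq0P x0; apply/colP => i; rewrite mxE.
apply/eqP; rewrite -sqrf_eq0 expr2 x0// => j _.
by rewrite -expr2 sqr_ge0.
Qed.

Lemma dot_gt0 x : (0 < dot x x) = (x != 0).
Proof. by rewrite lt0r dot_ge0 andbT dot_eq0. Qed.

Lemma norm2_ge0 x : 0 <= norm2 x.
Proof. exact: sqrtr_ge0. Qed.

Lemma norm2_sqr x : norm2 x ^+ 2 = dot x x.
Proof.
rewrite /norm2 (eq_bigr (fun i => x i ord0 * x i ord0)) => [|i _]; last exact: expr2.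
by rewrite -dotE sqr_sqrtr// dot_ge0.
Qed.

Lemma norm2E x : norm2 x = Num.sqrt (dot x x).
Proof. by rewrite -norm2_sqr sqrtr_sqr ger0_norm// norm2_ge0. Qed.

Lemma norm2Z a x : norm2 (a *: x) = `|a| * norm2 x.
Proof.
by rewrite !norm2E dotZl dotZr mulrA -expr2 sqrtrM ?sqr_ge0// sqrtr_sqr.
Qed.

Lemma norm2_eq0 x : (norm2 x == 0) = (x == 0).
Proof. by rewrite -sqrf_eq0 norm2_sqr dot_eq0. Qed.

Lemma cauchy_schwarz x y : `|dot x y| <= norm2 x * norm2 y.
Proof.
have [->|y0] := eqVneq y 0.
  by rewrite dot0r normr0 mulr_ge0// norm2_ge0.
have yy : 0 < dot y y by rewrite dot_gt0.
rewrite -ler_sqr ?nnegrE ?mulr_ge0 ?norm2_ge0// real_normK ?num_real//.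
rewrite exprMn !norm2_sqr.
have := dot_ge0 (dot y y *: x - dot x y *: y).
rewrite dotBl !dotBr !dotZl !dotZr (dotC y x) => h.
have : 0 <= dot y y * (dot x x * dot y y - dot x y ^+ 2) by nra.
by rewrite pmulr_rge0// subr_ge0.
Qed.

Definition psd A : Prop := A^T = A /\ forall x, 0 <= dot x (A *m x).

Lemma posdef_psd A : posdef A -> psd A.
Proof.
move=> [sA pA]; split => // x.
have [->|/pA] := eqVneq x 0; first by rewrite mulmx0 dot0r.
by rewrite sqnormE => /ltW.
Qed.

(** The form is nonnegative at x + t A x for every t, while its part linear in t
is 2 t |A x|^2; a small negative t would make it negative if A x were nonzero. *)
Lemma psd_isotropic A x : psd A -> dot x (A *m x) = 0 -> A *m x = 0.
Proof.
move=> [sA pA] x0; set y := A *m x; apply/eqP; rewrite -dot_eq0.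
have c0 := pA y; set c := dot y (A *m y) in c0.
set q := dot y y; have q0 : 0 <= q by exact: dot_ge0.
have xAy : dot x (A *m y) = q by rewrite dot_mulmx sA.
have h t : 0 <= t * q *+ 2 + t ^+ 2 * c.
  have := pA (x + t *: y).
  rewrite mulmxDr -scalemxAr !dotDl !dotDr !dotZl !dotZr xAy x0.
  by rewrite -/y -/q -/c; lra.
(* This t is close to the minimizer - q / c; adding 1 keeps it defined for c = 0. *)
have := h (- q / (1 + c)); rewrite -mulr_natr.
have c1 : 1 + c != 0 by rewrite gt_eqF// ltr_wpDr.
rewrite (_ : _ + _ = - (q ^+ 2 * (2 + c)) / (1 + c) ^+ 2); last by field.
rewrite pmulr_lge0 ?invr_gt0 ?exprn_gt0 ?ltr_wpDr//.
rewrite oppr_ge0 pmulr_lle0 ?ltr_wpDr// => q2.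
by rewrite -sqrf_eq0 eq_le q2 sqr_ge0.
Qed.

End dot_product.

Section spectral.
Context {R : realType}.

Lemma continuous_dot {T : topologicalType} n (f g : T -> 'cV[R]_n) :
  (forall i, continuous (fun t => f t i ord0)) ->
  (forall i, continuous (fun t => g t i ord0)) ->
  continuous (fun t => dot (f t) (g t)).
Proof.
move=> cf cg; under eq_fun do rewrite dotE.
apply: (continuous_big add_continuous) => i _ t.
by apply: cvgM; [exact: cf|exact: cg].
Qed.

Lemma continuous_mulmx {T : topologicalType} n (A : 'M[R]_n) (f : T -> 'cV[R]_n) :
  (forall i, continuous (fun t => f t i ord0)) ->
  forall i, continuous (fun t => (A *m f t) i ord0).
Proof.
move=> cf i; under eq_fun do rewrite mxE.
apply: (continuous_big add_continuous) => j _ t.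
by apply: cvgM; [exact: cvg_cst|exact: cf].
Qed.

(** The quadratic form attains its maximum l on the unit sphere, at v say. Then
l I - S is positive semidefinite and its form vanishes at v, so that v lies in
its kernel by [psd_isotropic]. *)
Lemma rayleigh_max n (S : 'M[R]_n) : (0 < n)%N -> S^T = S ->
  exists l v, [/\ dot v v = 1, S *m v = l *: v &
    forall x, dot x (S *m x) <= l * dot x x].
Proof.
case: n => // n in S *; move=> _ sS.
(* The sphere consists of row vectors so that [bounded_closed_compact] applies. *)
pose sphere := [set w : 'rV[R]_n.+1 | dot w^T w^T = 1].
have ctr (i : 'I_n.+1) : continuous (fun w : 'rV[R]_n.+1 => w^T i ord0).
  by move=> w; under eq_fun do rewrite mxE; exact: coord_continuous.
have sphere0 : sphere !=set0.
  exists (delta_mx ord0 ord0); rewrite /sphere /= dotE (bigD1 ord0)//= big1.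
    by rewrite !mxE !eqxx mulr1 addr0.
  by move=> i /negbTE i0; rewrite !mxE i0 andbF mul0r.
have sphere_compact : compact sphere.
  apply: bounded_closed_compact.
    exists 1; split => [|M M1 w]; first exact: num_real.
    move=> ww1; rewrite /= [leLHS]/Num.norm/= mx_normrE; apply/bigmax_leP; split=> [|[i j] _].
      by apply: ltW; apply: lt_trans M1.
    apply: le_trans (ltW M1); rewrite -(@expr_le1 _ 2)//= real_normK ?num_real//.
    rewrite (ord1 i) -[leRHS]ww1 dotE (bigD1 j)//= !mxE expr2 lerDl.
    by apply: sumr_ge0 => k _; rewrite -expr2 sqr_ge0.
  rewrite (_ : sphere = (fun w : 'rV[R]_n.+1 => dot w^T w^T) @^-1` [set 1])//.
  apply: preimage_closed; last exact: closed_eq.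
  by move=> w _; exact: continuous_dot.
have cS : {within sphere, continuous (fun w : 'rV[R]_n.+1 => dot w^T (S *m w^T))}.
  by apply: continuous_subspaceT; apply: continuous_dot => //; exact: continuous_mulmx.
have [w ws wmax] := compact_EVT_max sphere0 sphere_compact cS.
have w1 : dot w^T w^T = 1 by move: ws; rewrite inE.
pose l := dot w^T (S *m w^T).
have lmax x : dot x (S *m x) <= l * dot x x.
  have [->|x0] := eqVneq x 0; first by rewrite mulmx0 !dot0r mulr0.
  have xx : 0 < dot x x by rewrite dot_gt0.
  have := wmax ((norm2 x)^-1 *: x^T); rewrite inE /sphere/= linearZ/= trmxK.
  rewrite !dotZl !dotZr -scalemxAr !dotZr !mulrA -!expr2 exprVn norm2_sqr.
  rewrite mulVf ?gt_eqF// => /(_ erefl).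
  by rewrite -/l mulrC ler_pdivrMr.
exists l, w^T; split => //.
pose T : 'M[R]_n.+1 := l%:M - S.
have TE x : dot x (T *m x) = l * dot x x - dot x (S *m x).
  by rewrite mulmxBl mul_scalar_mx dotBr dotZr.
have : T *m w^T = 0.
  apply: psd_isotropic; last by rewrite TE w1 mulr1 subrr.
  split=> [|x]; last by rewrite TE subr_ge0.
  by rewrite linearB/= tr_scalar_mx sS.
by rewrite mulmxBl mul_scalar_mx => /eqP; rewrite subr_eq0 => /eqP.
Qed.

(** Deflation: if v is a unit eigenvector for the largest eigenvalue l > 0, then
S - l v v^T is positive semidefinite of smaller rank and kills v. A square root A
of it that kills its kernel has A v = 0, so that A + sqrt l v v^T squares to S.
The clause on kernels is what the induction needs to obtain A v = 0. *)
Lemma psd_sqrt n (S : 'M[R]_n) : psd S ->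
  exists A : 'M[R]_n, [/\ psd A, A *m A = S & forall x : 'cV[R]_n, S *m x = 0 -> A *m x = 0].
Proof.
have [r] := ubnP (\rank S); elim: r S => // r IHr S rS pS.
have [->|S0] := eqVneq S 0.
  exists 0; split=> //; rewrite ?mul0mx//.
  by split=> [|x]; rewrite ?trmx0// mul0mx dot0r.
have n0 : (0 < n)%N.
  by case: n S S0 {rS pS IHr} => // S; rewrite flatmx0 eqxx.
have [sS S_ge0] := pS.
have [l [v [v1 Sv lmax]]] := rayleigh_max n0 sS.
have l0 : 0 < l.
  rewrite ltNge; apply/negP => l0; move/eqP : S0; apply.
  apply/matrixP => i j; rewrite mxE.
  have /colP/(_ i) : S *m (delta_mx j ord0 : 'cV_n) = 0.
    apply: psd_isotropic => //; apply/eqP; rewrite eq_le S_ge0 andbT.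
    by rewrite (le_trans (lmax _))// mulr_le0_ge0// dot_ge0.
  by rewrite -colE !mxE.
have vv : v^T *m v = 1%:M by rewrite [LHS]mx11_scalar -/(dot v v) v1.
pose S' := S - l *: (v *m v^T).
have S'v : S' *m v = 0.
  by rewrite mulmxBl -scalemxAl -mulmxA vv mulmx1 Sv subrr.
have vS : (v^T <= S)%MS.
  apply/submxP; exists (l^-1 *: v^T).
  rewrite -scalemxAl -[S in RHS]trmxK -trmx_mul sS Sv linearZ/= scalerA.
  by rewrite mulVf ?gt_eqF// scale1r.
(* The row v^T lies in the row space of S but not in that of S'. *)
have S'S : (S' < S)%MS.
  rewrite /ltmx; apply/andP; split.
    by rewrite addmx_sub// eqmx_opp scalemx_sub// mulmx_sub.
  apply/negP => /(submx_trans vS)/submxP[w wE].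
  have : v^T *m v = 0 by rewrite wE -mulmxA S'v mulmx0.
  by rewrite vv => /matrixP/(_ ord0 ord0)/eqP; rewrite !mxE oner_eq0.
have sS' : S'^T = S' by rewrite linearB/= linearZ/= trmx_mul trmxK sS.
have vvE x : (v *m v^T) *m x = dot v x *: v.
  by rewrite -mulmxA [v^T *m x]mx11_scalar mul_mx_scalar.
have pS' : psd S'.
  split=> // x; pose y := x - dot v x *: v.
  have -> : S' *m x = S' *m y by rewrite mulmxBr -scalemxAr S'v scaler0 subr0.
  have vy : dot v y = 0 by rewrite dotBr dotZr v1 mulr1 subrr.
  rewrite dot_mulmx sS'.
  have -> : S' *m x = S' *m y by rewrite mulmxBr -scalemxAr S'v scaler0 subr0.
  by rewrite mulmxBl -scalemxAl vvE vy scale0r scaler0 subr0 dotC.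
have [A [pA AA kA]] := IHr S' (leq_trans (rank_ltmx S'S) rS) pS'.
have Av : A *m v = 0 by exact: kA.
have vA : v^T *m A = 0 by rewrite -[A]trmxK -trmx_mul pA.1 Av trmx0.
pose s := Num.sqrt l; have ss : s * s = l by rewrite -expr2 sqr_sqrtr// ltW.
exists (A + s *: (v *m v^T)); split.
- split=> [|x]; first by rewrite linearD/= linearZ/= trmx_mul trmxK pA.1.
  rewrite mulmxDl -scalemxAl vvE dotDr !dotZr (dotC x v).
  by rewrite addr_ge0 ?pA.2// mulr_ge0 ?sqrtr_ge0// -expr2 sqr_ge0.
- rewrite mulmxDl !mulmxDr AA -!scalemxAl -!scalemxAr.
  rewrite -mulmxA vA mulmx0 mulmxA Av mul0mx !scaler0 addr0 add0r scalerA ss.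
  by rewrite -mulmxA (mulmxA v^T) vv mul1mx /S' subrK.
- move=> x Sx; have vx : dot v x = 0.
    have : dot v (S *m x) = 0 by rewrite Sx dot0r.
    rewrite dot_mulmx sS Sv dotZl => /eqP; rewrite mulf_eq0 gt_eqF//=.
    by move/eqP.
  rewrite mulmxDl -scalemxAl vvE vx scale0r scaler0 addr0 kA//.
  by rewrite mulmxBl -scalemxAl vvE vx scale0r scaler0 subr0.
Qed.

Lemma posdef_unitmx n (A : 'M[R]_n) : posdef A -> A \in unitmx.
Proof.
move=> [sA pA]; rewrite -row_free_unit -kermx_eq0.
apply/negPn/negP => /rowV0Pn[w /sub_kermxP wA w0].
have := pA w^T; rewrite trmx_eq0 => /(_ w0).
by rewrite sqnormE -[A]trmxK -trmx_mul sA wA trmx0 dot0r ltxx.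
Qed.

Lemma posdef_inv n (A : 'M[R]_n) : posdef A -> posdef (invmx A).
Proof.
move=> pA; have uA := posdef_unitmx pA; have [sA A0] := pA.
have sV : (invmx A)^T = invmx A by rewrite trmx_inv sA.
split=> // x x0; rewrite sqnormE.
have -> : dot x (invmx A *m x) = sqnorm A (invmx A *m x).
  by rewrite sqnormE mulKVmx// dotC.
apply: A0; apply: contra_neq x0 => Ax.
by rewrite -[x](mulKVmx uA) Ax mulmx0.
Qed.

Lemma psd_unit_posdef n (A : 'M[R]_n) : psd A -> A \in unitmx -> posdef A.
Proof.
move=> pA uA; split; first exact: pA.1.
move=> x x0; rewrite sqnormE lt0r pA.2 andbT; apply: contra_neq x0 => xAx.
by rewrite -[x](mulKmx uA) (psd_isotropic pA xAx) mulmx0.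
Qed.

(** [invsqrtmx] is defined by a choice, which is meaningful once a positive
definite square root of the inverse is known to exist. *)
Lemma invsqrtmxP n (S : 'M[R]_n) : posdef S ->
  posdef (invsqrtmx S) /\ invsqrtmx S *m invsqrtmx S = invmx S.
Proof.
move=> pS; pose X := [set A : 'M[R]_n | posdef A /\ A *m A = invmx S].
suff : X (xget 0 X) by [].
apply: xgetPex; have pV := posdef_inv pS.
have [A [pA AA _]] := psd_sqrt (posdef_psd pV).
exists A; split => //; apply: psd_unit_posdef => //.
by have := posdef_unitmx pV; rewrite -AA unitmx_mul => /andP[].
Qed.

(** Polarization expresses y^T A z by the values of the form at y + z and y - z,
whence |y^T A z| <= c (|y|^2 + |z|^2) / 2. The bound follows by taking for y the
multiple of A x that has the norm of x, and z = x. *)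
Lemma norm2_symm_le n (A : 'M[R]_n) c x : 0 <= c -> A^T = A ->
  (forall y, `|dot y (A *m y)| <= c * dot y y) ->
  norm2 (A *m x) <= c * norm2 x.
Proof.
move=> c0 sA cA.
have polar y z : dot y (A *m z) <= c / 2 * (dot y y + dot z z).
  have := cA (y + z); have := cA (y - z).
  rewrite !mulmxDr !mulmxN !dotDl !dotDr !dotNl !dotNr.
  have -> : dot z (A *m y) = dot y (A *m z) by rewrite dot_mulmx sA dotC.
  by rewrite !ler_norml => /andP[? _] /andP[_ ?]; lra.
have [->|Ax0] := eqVneq (A *m x) 0.
  by rewrite norm2E dot0r sqrtr0 mulr_ge0// norm2_ge0.
have x0 : x != 0 by apply: contra_neq Ax0 => ->; rewrite mulmx0.
have Nx : 0 < norm2 x by rewrite lt0r norm2_eq0 x0 norm2_ge0.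
have NAx : 0 < norm2 (A *m x) by rewrite lt0r norm2_eq0 Ax0 norm2_ge0.
have := polar ((norm2 x / norm2 (A *m x)) *: (A *m x)) x.
rewrite !dotZl dotZr -!norm2_sqr.
rewrite (_ : _ / _ * _ = norm2 x * norm2 (A *m x)); last by field; rewrite gt_eqF.
rewrite (_ : _ * (_ + _) = norm2 x * (c * norm2 x)); last by field; rewrite gt_eqF.
by rewrite ler_pM2l.
Qed.

Lemma spectral_norm_le n (A : 'M[R]_n) c :
  (forall x, norm2 (A *m x) <= c * norm2 x) -> 0 <= c ->
  spectral_norm A <= c.
Proof.
move=> cA c0; apply: ge_sup.
  by exists (norm2 (A *m 0)), 0 => //=; rewrite norm2E dot0r sqrtr0.
by move=> _ [x /= x1 <-]; rewrite (le_trans (cA x))// ler_piMr.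
Qed.

(** The bound c ensures that the supremum defining the spectral norm is that of a
bounded set. *)
Lemma spectral_norm_form n (A : 'M[R]_n) c x :
  (forall x, norm2 (A *m x) <= c * norm2 x) -> 0 <= c ->
  dot x (A *m x) <= spectral_norm A * dot x x.
Proof.
move=> cA c0; have [->|x0] := eqVneq x 0; first by rewrite mulmx0 !dot0r mulr0.
have Nx : 0 < norm2 x by rewrite lt0r norm2_eq0 x0 norm2_ge0.
suff Ax : norm2 (A *m x) <= spectral_norm A * norm2 x.
  apply: (le_trans (ler_norm _)); apply: (le_trans (cauchy_schwarz _ _)).
  by rewrite -norm2_sqr expr2 mulrA mulrC ler_wpM2r// norm2_ge0.
rewrite -ler_pdivrMr// mulrC -[_^-1]gtr0_norm ?invr_gt0// -norm2Z scalemxAr.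
apply: ub_le_sup; last first.
  exists ((norm2 x)^-1 *: x) => //=.
  by rewrite norm2Z gtr0_norm ?invr_gt0// mulVf// gt_eqF.
by exists c => _ [y /= y1 <-]; rewrite (le_trans (cA y))// ler_piMr.
Qed.

(** The minimum of the quadratic form on the sphere, which [rayleigh_max] provides
for the opposite matrix, is an eigenvalue and bounds every other one from below. *)
Lemma lambda_minP n (S : 'M[R]_n) : (0 < n)%N -> posdef S ->
  0 < lambda_min S /\ forall x, lambda_min S * dot x x <= dot x (S *m x).
Proof.
move=> n0 pS; have [sS S0] := pS.
have sN : (- S)^T = - S by rewrite linearN/= sS.
have [l [v [v1 Sv lmax]]] := rayleigh_max n0 sN.
have {}lmax x : - l * dot x x <= dot x (S *m x).
  by have := lmax x; rewrite mulNmx dotNr mulNr lerNl.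
have {}Sv : S *m v = - l *: v by rewrite scaleNr -Sv mulNmx opprK.
suff -> : lambda_min S = - l.
  split=> //; have := S0 v; rewrite sqnormE Sv dotZr v1 mulr1; apply.
  by rewrite -dot_eq0 v1 oner_eq0.
have lE : eigenvalue S (- l).
  apply/eigenvalueP; exists v^T; last by rewrite trmx_eq0 -dot_eq0 v1 oner_eq0.
  by rewrite -[S]trmxK -trmx_mul sS Sv linearZ.
have lb : lbound [set a | eigenvalue S a] (- l).
  move=> a /eigenvalueP[w wS w0].
  have ww : 0 < dot w^T w^T by rewrite dot_gt0 trmx_eq0.
  have := lmax w^T; rewrite -[in X in _ <= X]sS -trmx_mul wS linearZ/= dotZr.
  by rewrite ler_pM2r.
apply/eqP; rewrite eq_le; apply/andP; split.
  by apply: ge_inf => //; exists (- l).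
by apply: lb_le_inf => //; exists (- l).
Qed.

End spectral.

(** * Measurability and integrability in R^n *)

Section borel_cV.
Context {R : realType} {n : nat}.
Implicit Types (C U : set 'cV[R]_n) (f : 'cV[R]_n -> R).

Lemma measurable_box_cV (A : 'I_n -> set R) : (forall i, measurable (A i)) ->
  measurable [set u : 'cV[R]_n | forall i, A i (u i ord0)].
Proof.
move=> mA; rewrite (_ : mkset _ = \bigcap_(i in [set: 'I_n])
    ((fun u : 'cV[R]_n => u i ord0) @^-1` A i)); last first.
  by apply/seteqP; split => v /= vB i; [move=> _|]; exact: vB.
apply: (fin_bigcap_measurable (@finite_finset _ [set: 'I_n])) => i _.
by rewrite -[X in measurable X]setTI; exact: measurable_coor.
Qed.

(** An open set is the union of the boxes with rational centre and inverse integer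
radius that it contains, and there are countably many of them. *)
Lemma open_measurable_cV U : open U -> measurable U.
Proof.
move=> oU.
pose box (p : 'cV[rat]_n * nat) :=
  [set y : 'cV[R]_n | forall i, `|ratr (p.1 i ord0) - y i ord0| < p.2.+1%:R^-1].
have mbox p : measurable (box p).
  apply: (@measurable_box_cV (fun i => ball (ratr (p.1 i ord0) : R) p.2.+1%:R^-1)).
  by move=> i; apply: open_measurable; exact: ball_open.
rewrite (_ : U = \bigcup_p [set y | box p `<=` U /\ box p y]).
  apply: countable_bigcupT_measurable => [|p]; first exact: countableP.
  have [pU|pU] := pselect (box p `<=` U).
    rewrite (_ : mkset _ = box p)//.
    by apply/seteqP; split => // y [].
  rewrite (_ : mkset _ = set0)//.
  by apply/seteqP; split => // y [].
apply/seteqP; split=> [x Ux|y [p _ [pU /pU]]//].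
have /nbhs_ballP[e /= e0 xeU] : nbhs x U by exact: open_nbhs_nbhs.
have [k ke] : exists k : nat, k.+1%:R^-1 < e / 2.
  have e2 : 0 < e / 2 by rewrite divr_gt0.
  by have [k _ /(_ k (leqnn k))] := near_infty_natSinv_lt (PosNum e2); exists k.
have /choice[q qx] : forall i, exists q : rat, `|ratr q - x i ord0| < k.+1%:R^-1.
  move=> i; have : x i ord0 < x i ord0 + k.+1%:R^-1 by rewrite ltrDl invr_gt0.
  move=> /rat_in_itvoo[q]; rewrite in_itv/= => /andP[q1 q2]; exists q.
  by rewrite gtr0_norm ?subr_gt0// ltrBlDl.
exists (\col_i q i, k) => //; split; last by move=> i /=; rewrite mxE; exact: qx.
move=> y /= yB; apply: xeU; split=> // i j; rewrite (ord1 j) /ball/=.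
have := yB i; rewrite mxE /= => yi; have := qx i => qi.
rewrite (le_lt_trans (ler_distD (ratr (q i)) _ _))// (distrC (x i ord0)).
by rewrite [e]splitr ltrD// (lt_trans _ ke).
Qed.

Lemma compact_measurable_cV C : compact C -> measurable C.
Proof.
move=> /(compact_closed (@norm_hausdorff _ _)) cC; rewrite -[C]setCK.
by apply: measurableC; apply: open_measurable_cV; exact: closed_openC.
Qed.

Lemma compact_finite_measure_cV C : compact C -> (lebesgue_cV n C < +oo)%E.
Proof.
move=> cC; have /ex_strict_bound_gt0[M M0 CM] := compact_bounded cC.
pose a : 'cV[R]_n := const_mx M.
have ab i : (- a) i ord0 <= a i ord0 by rewrite !mxE; lra.
apply: (@le_lt_trans _ _ (lebesgue_cV n
  [set u | forall i, (- a) i ord0 <= u i ord0 <= a i ord0])); last first.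
  by rewrite lebesgue_cV_box// ltry.
apply: le_measure; rewrite ?inE.
- exact: compact_measurable_cV.
- apply: (@measurable_box_cV (fun i => `[(- a) i ord0, a i ord0]%classic)) => i.
  exact: measurable_itv.
move=> u Cu i; rewrite !mxE -ler_norml; apply: le_trans (ltW (CM _ Cu)).
by rewrite [leRHS]/Num.norm/= mx_normrE; apply/bigmax_geP; right => /=; exists (i, ord0).
Qed.

Lemma continuous_measurable_cV f : continuous f -> measurable_fun setT f.
Proof.
move=> /continuousP cf; apply: (measurability _ (RGenOpens.measurableE R)).
move=> _ [_ [a [b ->] <-]]; rewrite setTI; apply: open_measurable_cV.
exact/cf/interval_open.
Qed.

Lemma continuous_bounded_on C f : compact C -> continuous f ->
  exists2 M, 0 < M & forall u, C u -> `|f u| <= M.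
Proof.
move=> cC cf.
have := compact_bounded (continuous_compact (continuous_subspaceT cf) cC).
move=> /ex_strict_bound_gt0[M M0 fM]; exists M => // u Cu.
by apply/ltW/fM; exists u.
Qed.

Lemma continuous_integrable_cV C f : compact C -> continuous f ->
  (lebesgue_cV n).-integrable C (EFin \o f).
Proof.
move=> cC cf; apply: measurable_bounded_integrable.
- exact: compact_measurable_cV.
- exact: compact_finite_measure_cV.
- by apply: measurable_funTS; exact: continuous_measurable_cV.
have [M M0 fM] := continuous_bounded_on cC cf.
exists M; split; first exact: num_real.
by move=> N MN u Cu; apply: (le_trans (fM u Cu)); exact: ltW.
Qed.

End borel_cV.

(** * One-variable calculus and summation of a decrease *)

Section calculus.
Context {R : realType}.
Implicit Types (f df ddf : R -> R) (s t : R).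

(** A quadratic bound on the first-order error is the form in which derivatives
pass through an integral: it only uses monotonicity of the integral. *)
Lemma is_derive_quadratic_error f t d K e : 0 < e ->
  (forall s, `|s| <= e -> `|f (t + s) - f t - s * d| <= K * s ^+ 2) ->
  is_derive t 1 f d.
Proof.
move=> e0 fK.
have cvf : h^-1 *: ((f \o shift t) (h *: (1 : R)) - f t) @[h --> 0^'] --> d.
  apply/cvgrPdist_le => /= eps eps0.
  have K0 : 0 < `|K| + 1 by rewrite ltr_wpDl.
  near=> h.
  have h0 : h != 0 by near: h; exact: nbhs_dnbhs_neq.
  have he : `|h| <= e.
    by near: h; apply: dnbhs0_le.
  have hK : `|h| <= eps / (`|K| + 1).
    by near: h; apply: dnbhs0_le; rewrite divr_gt0.
  rewrite /= [h *: (1 : R)]mulr1 (addrC h) distrC.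
  rewrite (_ : _ - d = h^-1 * (f (t + h) - f t - h * d)); last first.
    by rewrite [in RHS]mulrBr mulKf.
  rewrite normrM normfV ler_pdivrMl ?normr_gt0//.
  apply: (le_trans (fK _ he)).
  rewrite -[h ^+ 2]real_normK ?num_real// expr2 mulrCA ler_wpM2l//.
  move: hK; rewrite ler_pdivlMr// mulrC; apply: le_trans.
  by rewrite ler_wpM2r// (le_trans (ler_norm K))// lerDl.
by apply: DeriveDef; [apply/cvg_ex; exists d|exact/cvg_lim].
Unshelve. all: by end_near. Qed.

(** Both bounds on exp x come from 1 + y <= exp y, at y = x and at y = - x. *)
Lemma expR_quadratic_error (x : R) : `|x| <= 1 / 2 ->
  `|expR x - 1 - x| <= 2 * x ^+ 2.
Proof.
rewrite ler_norml => /andP[x1 x2].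
have e1 := expR_ge1Dx x; have e2 := expR_ge1Dx (- x).
have x21 : 0 < 1 - x by lra.
have : expR x <= (1 - x)^-1.
  by rewrite -[expR x]invrK -expRN lef_pV2 ?posrE ?expR_gt0.
rewrite -[leRHS]mul1r ler_pdivlMr// => e3.
rewrite ger0_norm; last lra.
have : (expR x - 1 - x) * (1 - x) <= x ^+ 2 by nra.
move=> h; have := expR_gt0 x => ?; nra.
Qed.

Lemma derive_le0_le f df t : (forall s, is_derive s 1 f (df s)) ->
  (forall s, 0 <= s -> df s <= 0) -> 0 <= t -> f t <= f 0.
Proof.
move=> fdf df0 t0.
have cf : {within `[0, t], continuous f}.
  apply: derivable_within_continuous => s _; exact: ex_derive.
have [c] := MVT_segment t0 (fun s _ => fdf s) cf.
rewrite in_itv/= => /andP[c0 _] ft.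
by rewrite -subr_le0 ft subr0 mulr_le0_ge0// df0.
Qed.

(** Subtracting K t reduces the claim to [derive_le0_le]. *)
Lemma derive_le_growth f df K t : (forall s, is_derive s 1 f (df s)) ->
  (forall s, df s <= K) -> 0 <= t -> f t <= f 0 + K * t.
Proof.
move=> fdf dfK t0.
have gd s : is_derive s 1 (fun x => f x - K * x) (df s - K).
  by have := fdf s => ?; apply: is_derive_eq; rewrite /= -[_ *: _]/(_ * _) mulr1.
have := derive_le0_le gd; rewrite mulr0 subr0 => /(_ t).
by rewrite lerBlDr; apply=> // s _; rewrite subr_le0.
Qed.

(** The derivative of the difference between f and its quadratic majorant is
nonpositive on the right of 0, by [derive_le_growth] applied to df. *)
Lemma taylor2_le f df ddf K :
  (forall s, is_derive s 1 f (df s)) -> (forall s, is_derive s 1 df (ddf s)) ->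
  (forall s, ddf s <= K) -> f 1 <= f 0 + df 0 + K / 2.
Proof.
move=> fd dfd ddfK.
have gd s : is_derive s 1 (fun x => f x - (df 0 * x + K / 2 * (x * x)))
    (df s - (df 0 + K * s)).
  have := fd s => ?; apply: is_derive_eq.
  by rewrite /= -![_ *: _]/(_ * _); lra.
have := derive_le0_le gd; rewrite !mulr0 addr0 subr0 => /(_ 1).
rewrite !mulr1 lerBlDr addrA; apply=> // s s0.
by rewrite subr_le0; exact: derive_le_growth.
Qed.

Lemma derive_line (V : normedModType R) (f : V -> R) (x h : V) :
  'D_h f x = 'D_1 (fun s : R => f (x + s *: h)) 0.
Proof.
have E (u v : R -> R) : u = v ->
  lim (u s @[s --> 0^']) = lim (v s @[s --> 0^']) by move=> ->.
apply: E; apply/funext => s.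
congr (_ *: (f _ - f _)); last by rewrite scale0r addr0.
rewrite /= addrC; congr (_ + _ *: _).
by rewrite addr0; exact/esym/mulr1.
Qed.

End calculus.

(** The bookkeeping of a descent method: f decreases by at least c g at each step
and stays above low. *)
Section summable_decrease.
Context {R : realType} (f g : nat -> R) (low c : R).
Hypotheses (c_gt0 : 0 < c) (g_ge0 : forall k, 0 <= g k).
Hypotheses (f_ge : forall k, low <= f k).
Hypothesis f_decr : forall k, f k.+1 <= f k - c * g k.

Lemma decrease_partial_sum n : \sum_(0 <= k < n) g k <= (f 0%N - low) / c.
Proof.
suff : c * (\sum_(0 <= k < n) g k) <= f 0%N - f n.
  by move=> h; rewrite ler_pdivlMr// mulrC (le_trans h)// lerD2l lerN2.
elim: n => [|n IHn]; first by rewrite big_nil mulr0 subrr.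
by rewrite big_nat_recr//= mulrDr; have := f_decr n; lra.
Qed.

Lemma decrease_series :
  (\sum_(0 <= k <oo) (g k)%:E <= ((f 0%N - low) / c)%:E)%E.
Proof.
apply: lime_le; first by apply: is_cvg_nneseries => k _ _; rewrite lee_fin.
by apply: nearW => n; rewrite sumEFin lee_fin decrease_partial_sum.
Qed.

Lemma decrease_min n : (1 <= n)%N ->
  \big[Num.min/g 0%N]_(j < n) g j <= (f 0%N - low) / (n%:R * c).
Proof.
move=> n1; have n0 : 0 < n%:R :> R by rewrite ltr0n.
rewrite (mulrC n%:R) invfM mulrA ler_pdivlMr//.
apply: le_trans (decrease_partial_sum n).
rewrite big_mkord mulr_natr -[X in _ *+ X](card_ord n) -sumr_const.
by apply: ler_sum => j _; apply: bigmin_le_cond.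
Qed.

Lemma decrease_cvg0 : Num.sqrt (g k) @[k --> \oo] --> (0 : R).
Proof.
have g0 : g @ \oo --> (0 : R).
  apply: cvg_series_cvg_0; apply: nondecreasing_is_cvgn.
    by apply: nondecreasing_series => k _ _; exact: g_ge0.
  by exists ((f 0%N - low) / c) => _ [n _ <-]; exact: decrease_partial_sum.
by rewrite -[X in _ --> X]sqrtr0; apply: continuous_cvg => //; exact: sqrt_continuous.
Qed.

End summable_decrease.

(** * Integrals of continuous functions over a compact set *)

(** Pointwise forms of the continuity rules, stated on lambda terms so that the
tactic below can select them from the shape of the function. *)
Section continuity_rules.
Context {R : realType} {T : topologicalType}.
Implicit Types f g : T -> R.

Lemma continuous_add f g : continuous f -> continuous g ->
  continuous (fun x => f x + g x).
Proof. by move=> cf cg x; apply: cvgD; [exact: cf|exact: cg]. Qed.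

Lemma continuous_opp f : continuous f -> continuous (fun x => - f x).
Proof. by move=> cf x; apply: cvgN; exact: cf. Qed.

Lemma continuous_mul f g : continuous f -> continuous g ->
  continuous (fun x => f x * g x).
Proof. by move=> cf cg x; apply: cvgM; [exact: cf|exact: cg]. Qed.

Lemma continuous_sqr f : continuous f -> continuous (fun x => f x ^+ 2).
Proof. by move=> cf; apply: (continuous_mul cf cf). Qed.

Lemma continuous_normr f : continuous f -> continuous (fun x => `|f x|).
Proof. by move=> cf x; apply: cvg_norm; exact: cf. Qed.

Lemma continuous_exp f : continuous f -> continuous (fun x => expR (f x)).
Proof. by move=> cf x; apply: continuous_cvg; [exact: continuous_expR|exact: cf]. Qed.

End continuity_rules.

Ltac continuity := repeat match goal with
  | |- continuous (fun _ => ?c) => exact: cst_continuous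
  | |- continuous (fun _ => _ + _) => apply: continuous_add
  | |- continuous (fun _ => - _) => apply: continuous_opp
  | |- continuous (fun _ => _ * _) => apply: continuous_mul
  | |- continuous (fun _ => _ ^+ 2) => apply: continuous_sqr
  | |- continuous (fun _ => `|_|) => apply: continuous_normr
  | |- continuous (fun _ => expR _) => apply: continuous_exp
  | cf : continuous ?f |- continuous ?f => exact: cf
  | cf : continuous ?f |- continuous (fun x => ?f x) => exact: cf
  | cf : forall _, continuous _ |- _ => exact: cf
  end.

Section compact_integral.
Context {R : realType} {n : nat}.
Implicit Types (a f g : 'cV[R]_n -> R) (c t : R).
Variable C : set 'cV[R]_n.
Hypothesis C_compact : compact C.

Let mC := compact_measurable_cV C_compact.
Let intC := fun f (cf : continuous f) => continuous_integrable_cV C_compact cf.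

(** Restricting attention to functions continuous on the whole space makes this a
positive linear functional without integrability side conditions. *)
Definition cint f : R := \int[lebesgue_cV n]_(u in C) f u.

Lemma eq_cint f g : (forall u, C u -> f u = g u) -> cint f = cint g.
Proof. by move=> fg; apply: eq_Rintegral => u; rewrite inE => /fg. Qed.

Lemma cintD f g : continuous f -> continuous g ->
  cint (fun u => f u + g u) = cint f + cint g.
Proof. by move=> cf cg; apply: RintegralD => //; exact: intC. Qed.

Lemma cintB f g : continuous f -> continuous g ->
  cint (fun u => f u - g u) = cint f - cint g.
Proof. by move=> cf cg; apply: RintegralB => //; exact: intC. Qed.

Lemma cintZ c f : continuous f -> cint (fun u => c * f u) = c * cint f.
Proof. by move=> cf; apply: RintegralZl => //; exact: intC. Qed.

Lemma le_cint f g : continuous f -> continuous g ->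
  (forall u, C u -> f u <= g u) -> cint f <= cint g.
Proof. by move=> cf cg fg; apply: le_Rintegral => //; exact: intC. Qed.

Lemma cint_sum I (r : seq I) (F : I -> 'cV[R]_n -> R) :
  (forall i, continuous (F i)) ->
  cint (fun u => \sum_(i <- r) F i u) = \sum_(i <- r) cint (F i).
Proof.
move=> cF; elim: r => [|i r IHr].
  rewrite big_nil -[RHS](mul0r (cint (fun=> 0))) -cintZ; last exact: cst_continuous.
  by apply: eq_cint => u _; rewrite big_nil mul0r.
rewrite big_cons -IHr -cintD//; last exact: (continuous_big add_continuous).
by apply: eq_cint => u _; rewrite big_cons.
Qed.

(** On the compact set f is bounded below by a positive constant. *)
Lemma cint_gt0 f : C !=set0 -> (0 < lebesgue_cV n C)%E -> continuous f ->
  (forall u, C u -> 0 < f u) -> 0 < cint f.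
Proof.
move=> C0 C_gt0 cf f0.
have [v] := compact_EVT_min C0 C_compact (continuous_subspaceT cf).
rewrite inE => Cv fv.
have : cint (fun=> f v) <= cint f.
  apply: le_cint => //; first exact: cst_continuous.
  by move=> u Cu; apply: fv; rewrite inE.
apply: lt_le_trans; rewrite /cint Rintegral_cst//.
apply: mulr_gt0; first exact: f0.
by rewrite fine_gt0// C_gt0 compact_finite_measure_cV.
Qed.

(** If |a| <= A on C, the first-order error of exp (s a) is at most 2 A^2 s^2 as
long as |s| <= 1 / (2 A), uniformly on C, and integrates to a quadratic error. *)
Lemma is_derive_cint_exp a g t : continuous a -> continuous g ->
  is_derive t 1 (fun s => cint (fun u => g u * expR (s * a u)))
    (cint (fun u => g u * expR (t * a u) * a u)).
Proof.
move=> ca cg; have [A A0 aA] := continuous_bounded_on C_compact ca.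
pose k u := g u * expR (t * a u).
have ck : continuous k by rewrite /k; continuity.
apply: (@is_derive_quadratic_error _ _ _ _
    (2 * A ^+ 2 * cint (fun u => `|k u|)) ((2 * A)^-1)).
  by rewrite invr_gt0 mulr_gt0.
move=> s sA.
have cr : continuous (fun u => k u * (expR (s * a u) - 1 - s * a u)) by continuity.
have -> : cint (fun u => g u * expR ((t + s) * a u)) -
    cint (fun u => g u * expR (t * a u)) - s * cint (fun u => k u * a u) =
    cint (fun u => k u * (expR (s * a u) - 1 - s * a u)).
  rewrite -cintZ; last by continuity.
  rewrite -!cintB; try by continuity.
  by apply: eq_cint => u _; rewrite /k mulrDl expRD; ring.
apply: le_trans (le_normr_Rintegral mC (intC cr)) _.
rewrite -[leRHS]mulrAC -cintZ; last by continuity.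
apply: le_cint; [by continuity|by continuity|move=> u Cu].
have sa : `|s * a u| <= 1 / 2.
  rewrite normrM (le_trans (ler_pM _ _ sA (aA u Cu)))//.
  by rewrite invfM -mulrA mulVf ?gt_eqF// mulr1 div1r.
rewrite normrM mulrC ler_wpM2r//.
apply: (le_trans (expR_quadratic_error sa)).
rewrite exprMn (mulrC (s ^+ 2)) mulrA ler_wpM2r ?sqr_ge0// ler_wpM2l//.
by rewrite -[a u ^+ 2]real_normK ?num_real// lerXn2r ?nnegrE ?aA// ltW.
Qed.

End compact_integral.

(** * The tilted Gaussian family *)

Section mppi_theory.
Context {R : realType} {m : nat}.
Variables (C : set 'cV[R]_m) (f0 : 'cV[R]_m -> R) (tau : R) (Sigma : 'M[R]_m).
Hypotheses (C_nonempty : C !=set0) (C_compact : compact C).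
Hypothesis C_pos : (0 < lebesgue_cV m C)%E.
Hypotheses (f0_continuous : continuous f0) (tau_gt0 : 0 < tau).
Hypothesis Sigma_posdef : posdef Sigma.
Implicit Types (b : 'cV[R]_m -> R) (mu h p x : 'cV[R]_m) (t : R).

Notation F := (free_energy C f0 tau Sigma).
Notation rho := (tilted C f0 tau Sigma).
Notation W := (invsqrtmx Sigma).
Notation L := (smoothness C f0 tau Sigma).
Notation DSigma := (diam_inv Sigma C).

Let uSigma : Sigma \in unitmx := posdef_unitmx Sigma_posdef.
Let Sigma_inv_posdef := posdef_inv Sigma_posdef.
Let Sigma_inv_sym : (invmx Sigma)^T = invmx Sigma := Sigma_inv_posdef.1.
Let W_sym : W^T = W := (invsqrtmxP Sigma_posdef).1.1.
Let WW : W *m W = invmx Sigma := (invsqrtmxP Sigma_posdef).2.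

Lemma continuous_coord_shift mu i : continuous (fun u : 'cV[R]_m => (u - mu) i ord0).
Proof.
under eq_fun do rewrite mxE [X in _ + X]mxE.
by apply: continuous_add; [exact: coord_continuous|exact: cst_continuous].
Qed.

Lemma continuous_dot_shift p mu : continuous (fun u : 'cV[R]_m => dot p (u - mu)).
Proof.
by apply: continuous_dot => i; [exact: cst_continuous|exact: continuous_coord_shift].
Qed.

Lemma continuous_dotl p : continuous (dot p).
Proof. by apply: continuous_dot => i; [exact: cst_continuous|exact: coord_continuous]. Qed.

(** The tilted density before normalization, without the indicator of C: unlike
[tilted] it is continuous everywhere, and integrals are taken over C instead. *)
Definition gibbs mu u := gaussian_pdf Sigma mu u * expR (- f0 u / tau).

Lemma continuous_gibbs mu : continuous (gibbs mu).
Proof.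
have cQ : continuous (fun u : 'cV[R]_m => sqnorm (invmx Sigma) (u - mu)).
  under eq_fun do rewrite sqnormE.
  apply: continuous_dot; first exact: continuous_coord_shift.
  by apply: continuous_mulmx; exact: continuous_coord_shift.
by rewrite /gibbs /gaussian_pdf; continuity.
Qed.
Let cgibbs := continuous_gibbs.

(** W is a square root of the inverse of Sigma, so det Sigma is the inverse of a
nonzero square. *)
Lemma det_Sigma_gt0 : 0 < \det Sigma.
Proof.
have : \det (W *m W) * \det Sigma = 1 by rewrite -det_mulmx WW mulVmx// det1.
rewrite det_mulmx -expr2 => dW.
have d0 : \det W ^+ 2 != 0.
  by apply/eqP => d0; move: dW; rewrite d0 mul0r => /eqP; rewrite eq_sym oner_eq0.
by rewrite -(@pmulr_rgt0 _ (\det W ^+ 2)) ?dW// lt0r d0 sqr_ge0.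
Qed.

Lemma gibbs_gt0 mu u : 0 < gibbs mu u.
Proof.
rewrite !mulr_gt0 ?expR_gt0// invr_gt0 sqrtr_gt0 mulr_gt0 ?det_Sigma_gt0//.
by rewrite exprn_gt0// mulr_gt0// pi_gt0.
Qed.

Lemma partition_funE mu : partition_fun C f0 tau Sigma mu = cint C (gibbs mu).
Proof. by []. Qed.

Lemma partition_fun_gt0 mu : 0 < partition_fun C f0 tau Sigma mu.
Proof. by rewrite partition_funE; apply: cint_gt0 => // u _; exact: gibbs_gt0. Qed.
Let Z_neq0 mu : partition_fun C f0 tau Sigma mu != 0 := lt0r_neq0 (partition_fun_gt0 mu).

Definition Erho mu b := cint C (fun u => gibbs mu u * b u) / partition_fun C f0 tau Sigma mu.

Lemma eq_Erho mu b b' : (forall u, C u -> b u = b' u) -> Erho mu b = Erho mu b'.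
Proof. by move=> bb; congr (_ / _); apply: eq_cint => u Cu; rewrite bb. Qed.

Lemma ErhoD mu b b' : continuous b -> continuous b' ->
  Erho mu (fun u => b u + b' u) = Erho mu b + Erho mu b'.
Proof.
move=> cb cb'; rewrite /Erho -mulrDl -cintD; [|exact: C_compact|by continuity..].
by congr (_ / _); apply: eq_cint => u _; rewrite mulrDr.
Qed.

Lemma ErhoZ mu c b : continuous b -> Erho mu (fun u => c * b u) = c * Erho mu b.
Proof.
move=> cb; rewrite /Erho mulrA -cintZ//; last by continuity.
by congr (_ / _); apply: eq_cint => u _; rewrite mulrCA.
Qed.

Lemma Erho_cst mu c : Erho mu (fun=> c) = c.
Proof.
rewrite /Erho (@eq_cint _ _ C _ (fun u => c * gibbs mu u)) => [|u _]; last exact: mulrC.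
by rewrite cintZ; [apply: mulfK; exact: Z_neq0|exact: C_compact|exact: cgibbs].
Qed.

Lemma le_Erho mu b b' : continuous b -> continuous b' ->
  (forall u, C u -> b u <= b' u) -> Erho mu b <= Erho mu b'.
Proof.
move=> cb cb' bb'; rewrite /Erho ler_pM2r ?invr_gt0 ?partition_fun_gt0//.
apply: le_cint => //; [by continuity|by continuity|move=> u Cu].
by rewrite ler_wpM2l ?bb'// ltW// gibbs_gt0.
Qed.

Lemma Erho_sum mu I (r : seq I) (G : I -> 'cV[R]_m -> R) :
  (forall i, continuous (G i)) ->
  Erho mu (fun u => \sum_(i <- r) G i u) = \sum_(i <- r) Erho mu (G i).
Proof.
move=> cG; rewrite /Erho -mulr_suml -cint_sum//; last by move=> i; continuity.
by congr (_ / _); apply: eq_cint => u _; rewrite mulr_sumr.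
Qed.

(** Taking for c the expectation of b gives the usual formula for the variance. *)
Lemma ErhoB_sqr mu b c : continuous b ->
  Erho mu (fun u => (b u - c) ^+ 2) = Erho mu (fun u => b u * b u) - 2 * c * Erho mu b + c ^+ 2.
Proof.
move=> cb.
rewrite (@eq_Erho _ _ (fun u => b u * b u + (- (2 * c) * b u + c ^+ 2))); last first.
  by move=> u _; ring.
by rewrite !ErhoD ?ErhoZ ?Erho_cst; [ring|continuity..].
Qed.

Lemma Rintegral_weight mu (b : 'cV[R]_m -> R) :
  \int[lebesgue_cV m]_u (gaussian_pdf Sigma mu u * (weight C f0 tau u * b u)) =
  cint C (fun u => gibbs mu u * b u).
Proof.
rewrite /cint [RHS]Rintegral_mkcond; apply: eq_Rintegral => u _.
rewrite patchE /weight indicE; case: ifP => _; first by rewrite mulr1 !mulrA.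
by rewrite mulr0 mul0r mulr0.
Qed.

Lemma expect_tiltedE mu k l (g : 'cV[R]_m -> 'M[R]_(k, l)) i j :
  continuous (fun u => g u i j) ->
  expect (rho mu) g i j = Erho mu (fun u => g u i j).
Proof.
move=> cg; rewrite mxE /Erho mulrC -cintZ; [|exact: C_compact|by continuity].
rewrite /cint [RHS]Rintegral_mkcond; apply: eq_Rintegral => u _.
rewrite patchE /tilted /weight indicE; case: ifP => _.
  by rewrite mulr1 /gibbs; ring.
by rewrite !mulr0 !mul0r.
Qed.

Lemma dot_mean mu p : dot p (mean (rho mu)) = Erho mu (dot p).
Proof.
have cE i : continuous (fun u : 'cV[R]_m => p i ord0 * u i ord0).
  by apply: continuous_mul; [exact: cst_continuous|exact: coord_continuous].
transitivity (Erho mu (fun u => \sum_i p i ord0 * u i ord0)).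
  rewrite Erho_sum// dotE; apply: eq_bigr => i _.
  by rewrite expect_tiltedE ?ErhoZ//; exact: coord_continuous.
by apply: eq_Erho => u _; rewrite dotE.
Qed.

Lemma Erho_dot_shift mu p c :
  Erho mu (fun u => dot p (u - c)) = dot p (mean (rho mu) - c).
Proof.
have cp : continuous (dot p) by exact: continuous_dotl.
rewrite dotBr dot_mean -[X in _ - X](Erho_cst mu) -[X in _ + X]mulN1r -ErhoZ -?ErhoD;
  [|by continuity..].
by apply: eq_Erho => u _; rewrite dotBr mulN1r.
Qed.

Lemma mppi_update mu : mean (rho mu) =
  (\int[lebesgue_cV m]_u (gaussian_pdf Sigma mu u * weight C f0 tau u))^-1 *:
    expect (gaussian_pdf Sigma mu) (fun u => weight C f0 tau u *: u).
Proof.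
apply/matrixP => i j; rewrite expect_tiltedE; last exact: coord_continuous.
rewrite /Erho mulrC mxE; congr (_^-1 * _).
  transitivity (cint C (fun u => gibbs mu u * 1)).
    by apply: eq_cint => u _; rewrite mulr1.
  by rewrite -Rintegral_weight; apply: eq_Rintegral => u _; rewrite mulr1.
rewrite mxE -Rintegral_weight; apply: eq_Rintegral => u _.
by rewrite [X in _ = _ * X]mxE.
Qed.

Lemma outer_coord (v : 'cV[R]_m) i j : (v *m v^T) i j = v i ord0 * v j ord0.
Proof. by rewrite mxE big_ord1 [X in _ * X]mxE. Qed.

(** The form of the covariance matrix at p is the variance of the linear function
u |-> p^T u. *)
Lemma covariance_form mu p : dot p (covariance_mx (rho mu) *m p) =
  Erho mu (fun u => dot p u * dot p u) - Erho mu (dot p) ^+ 2.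
Proof.
set c := mean (rho mu).
have cc i : continuous (fun u : 'cV[R]_m => (u - c) i ord0) by exact: continuous_coord_shift.
have covE i j : covariance_mx (rho mu) i j =
    Erho mu (fun u => (u - c) i ord0 * (u - c) j ord0).
  rewrite expect_tiltedE; last first.
    rewrite (_ : (fun _ => _) = (fun u => (u - c) i ord0 * (u - c) j ord0)).
      by continuity.
    by apply/funext => u; exact: outer_coord.
  by apply: eq_Erho => u _; exact: outer_coord.
transitivity (Erho mu (fun u => \sum_i \sum_j
    (p i ord0 * p j ord0) * ((u - c) i ord0 * (u - c) j ord0))).
  rewrite Erho_sum; last first.
    by move=> i; apply: (continuous_big add_continuous) => j _; continuity.
  rewrite dotE; apply: eq_bigr => i _; rewrite Erho_sum; last by move=> j; continuity.
  rewrite mxE mulr_sumr; apply: eq_bigr => j _.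
  by rewrite covE ErhoZ; [ring|continuity].
transitivity (Erho mu (fun u => (dot p u - Erho mu (dot p)) ^+ 2)).
  apply: eq_Erho => u _; rewrite -dot_mean -dotBr -/c dotE expr2 mulr_suml.
  apply: eq_bigr => i _; rewrite mulr_sumr; apply: eq_bigr => j _; ring.
by rewrite ErhoB_sqr; [ring|exact: continuous_dotl].
Qed.

Lemma covariance_sym mu : (covariance_mx (rho mu))^T = covariance_mx (rho mu).
Proof.
apply/matrixP => i j; rewrite 3!mxE; apply: eq_Rintegral => u _.
by rewrite !outer_coord [X in _ * X]mulrC.
Qed.

(** Completing the square: moving the mean by t h multiplies the density by a
constant and by the exponential of a function affine in u. *)
Lemma gibbs_line mu h t u :
  gibbs (mu + t *: h) u = expR (- (t * t * dot h (invmx Sigma *m h) / 2)) *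
    (gibbs mu u * expR (t * dot (invmx Sigma *m h) (u - mu))).
Proof.
rewrite /gibbs /gaussian_pdf !sqnormE.
set p := invmx Sigma *m h; rewrite opprD addrA; move: (u - mu) => v.
have vp : dot h (invmx Sigma *m v) = dot p v by rewrite dot_mulmx Sigma_inv_sym.
rewrite mulmxBr -scalemxAr -/p dotBl !dotBr !dotZl !dotZr vp (dotC v p).
rewrite (_ : - (_ / 2) = - (t * t * dot h p / 2) +
  (- (dot v (invmx Sigma *m v) / 2) + t * dot p v)); last by field.
by rewrite !expRD; ring.
Qed.

Let slope mu h u := dot (invmx Sigma *m h) (u - mu).
(* Exponential moments along the line through mu directed by h. The factor
   exp (- t^2 H / 2) of the previous lemma cancels in the quotients below. *)
Let tiltint mu h b t := cint C (fun u => gibbs mu u * b u * expR (t * slope mu h u)).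

Let cslope mu h : continuous (slope mu h).
Proof. exact: continuous_dot_shift. Qed.

Let tiltint_derive mu h b t : continuous b ->
  is_derive t 1 (tiltint mu h b) (tiltint mu h (fun u => b u * slope mu h u) t).
Proof.
move=> cb; rewrite /tiltint.
have cg : continuous (fun u => gibbs mu u * b u) by continuity.
have := is_derive_cint_exp C_compact t (@cslope mu h) cg.
by move=> ?; apply: is_derive_eq; apply: eq_cint => u _; ring.
Qed.

Let tiltintE mu h b t : continuous b ->
  cint C (fun u => gibbs (mu + t *: h) u * b u) =
  expR (- (t * t * dot h (invmx Sigma *m h) / 2)) * tiltint mu h b t.
Proof.
move=> cb; have csl := @cslope mu h.
rewrite -cintZ; [|exact: C_compact|by continuity].
by apply: eq_cint => u _; rewrite gibbs_line -/(slope mu h u); ring.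
Qed.

Let tiltint1 mu h t : partition_fun C f0 tau Sigma (mu + t *: h) =
  expR (- (t * t * dot h (invmx Sigma *m h) / 2)) * tiltint mu h (fun=> 1) t.
Proof.
rewrite -tiltintE; last exact: cst_continuous.
by apply: eq_cint => u _; rewrite mulr1.
Qed.

Let tiltint1_gt0 mu h t : 0 < tiltint mu h (fun=> 1) t.
Proof.
have := partition_fun_gt0 (mu + t *: h).
by rewrite tiltint1 pmulr_rgt0 ?expR_gt0.
Qed.

Let Erho_line mu h b t : continuous b ->
  Erho (mu + t *: h) b = tiltint mu h b t / tiltint mu h (fun=> 1) t.
Proof.
move=> cb; rewrite /Erho (tiltintE _ _ _ cb) tiltint1.
by rewrite -mulf_div divff ?mul1r// gt_eqF ?expR_gt0.
Qed.

(** On the line, F is tau (t^2 H / 2 - ln M(t)), where M is the exponential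
integral of the slope; the quotient M' / M is an expectation under rho. *)
Lemma free_energy_line_derive mu h t :
  is_derive t 1 (fun s => F (mu + s *: h))
    (tau * (t * dot h (invmx Sigma *m h) -
            Erho (mu + t *: h) (fun u => dot (invmx Sigma *m h) (u - mu)))).
Proof.
set H := dot h _.
have c1 : continuous (fun _ : 'cV[R]_m => 1 : R) by exact: cst_continuous.
have FE s : F (mu + s *: h) = tau * (s * s * H / 2) - tau * ln (tiltint mu h (fun=> 1) s).
  rewrite /free_energy tiltint1 lnM ?posrE ?expR_gt0// expRK -/H; ring.
under eq_fun do rewrite FE.
have dM := tiltint_derive mu h t c1.
have dln := is_derive1_comp (is_derive1_ln (tiltint1_gt0 mu h t)) dM.
apply: is_derive_eq.
rewrite -![_ *: _]/(_ * _) Erho_line; last exact: cslope.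
rewrite (_ : tiltint mu h (slope mu h) t =
             tiltint mu h (fun u => 1 * slope mu h u) t); last first.
  by apply: eq_cint => u _; rewrite mul1r.
have M0 := tiltint1_gt0 mu h t; clear FE dM dln.
move: (tiltint mu h (fun=> 1) t) (tiltint mu h _ t) H M0 => M N H M0.
by field; rewrite gt_eqF.
Qed.

(** Differentiating the quotient M' / M once more gives M'' / M - (M' / M)^2, which
is a variance under rho. *)
Lemma mean_line_derive mu h t :
  let p := invmx Sigma *m h in
  is_derive t 1 (fun s => Erho (mu + s *: h) (fun u => dot p (u - mu)))
    (dot p (covariance_mx (rho (mu + t *: h)) *m p)).
Proof.
move=> p; have csl := @cslope mu h.
have c1 : continuous (fun _ : 'cV[R]_m => 1 : R) by exact: cst_continuous.
under eq_fun do rewrite (Erho_line _ _ _ csl).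
have M0 : tiltint mu h (fun=> 1) t != 0 by rewrite gt_eqF.
have dM := tiltint_derive mu h t c1.
have dN := tiltint_derive mu h t csl.
have dV := is_deriveV M0 dM.
apply: is_derive_eq; rewrite -![_ *: _]/(_ * _).
(* A variance does not change when the function is shifted by a constant. *)
have nu1 : dot p (covariance_mx (rho (mu + t *: h)) *m p) =
    Erho (mu + t *: h) (fun u => slope mu h u * slope mu h u) -
    Erho (mu + t *: h) (slope mu h) ^+ 2.
  rewrite covariance_form; set nu := mu + t *: h.
  have cp : continuous (dot p) by exact: continuous_dotl.
  have slopeE u : slope mu h u = dot p u + - dot p mu by rewrite /slope dotBr.
  rewrite [Erho nu (slope mu h)]Erho_dot_shift dotBr dot_mean.
  rewrite [X in _ = X - _](@eq_Erho nu _ (fun u => (dot p u - dot p mu) ^+ 2)).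
    by rewrite ErhoB_sqr//; ring.
  by move=> u _; rewrite slopeE expr2.
rewrite nu1 !Erho_line; [|by continuity..].
rewrite (_ : tiltint mu h (slope mu h) t =
             tiltint mu h (fun u => 1 * slope mu h u) t); last first.
  by apply: eq_cint => u _; rewrite mul1r.
by field.
Qed.

Lemma gradient_free_energy mu :
  gradient F mu = tau *: (invmx Sigma *m (mu - mean (rho mu))).
Proof.
apply/colP => i; rewrite mxE [RHS]mxE; set h : 'cV[R]_m := delta_mx i ord0.
have := free_energy_line_derive mu h 0; rewrite mul0r sub0r scale0r addr0 => dF.
rewrite (derive_line F) derive_val.
have coordE (v : 'cV[R]_m) : dot h v = v i ord0.
  rewrite dotE (bigD1 i)//= !mxE !eqxx mul1r big1 ?addr0// => j /negbTE ji.
  by rewrite mxE ji mul0r.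
have dot_SigmaV (v : 'cV[R]_m) : dot (invmx Sigma *m h) v = (invmx Sigma *m v) i ord0.
  by rewrite -coordE dot_mulmx Sigma_inv_sym.
by rewrite -dot_SigmaV Erho_dot_shift -dotNr opprB.
Qed.

(** With d = E_rho[u] - mu, the gradient is - tau Sigma^-1 d and P undoes one of
the two factors tau Sigma^-1. *)
Lemma gradient_sqnorm mu :
  sqnorm (tau^-1 *: Sigma) (gradient F mu) =
  tau * dot (mean (rho mu) - mu) (invmx Sigma *m (mean (rho mu) - mu)).
Proof.
rewrite gradient_free_energy -opprB; set d := mean (rho mu) - mu.
rewrite sqnormE mulmxN scalerN mulmxN dotNr dotNl opprK.
rewrite -scalemxAl -scalemxAr mulKVmx// scalerA mulVf ?gt_eqF// scale1r.
by rewrite dotZl dotC.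
Qed.

(** Used with A = W and with A = I: the suprema defining the two diameters are
taken over bounded sets. *)
Lemma has_ubound_diff (A : 'M[R]_m) :
  has_ubound [set norm2 (A *m (u - v)) | u in C & v in C].
Proof.
have cA : continuous (fun u : 'cV[R]_m => dot (A *m u) (A *m u)).
  by apply: continuous_dot; apply: continuous_mulmx => i; exact: coord_continuous.
have [B B0 AB] := continuous_bounded_on C_compact cA.
exists (Num.sqrt (4 * B)) => _ [u Cu [v Cv <-]].
rewrite norm2E ler_wsqrtr// mulmxBr.
have := dot_ge0 (A *m u + A *m v).
have := le_trans (ler_norm _) (AB u Cu); have := le_trans (ler_norm _) (AB v Cv).
by rewrite !dotDl !dotDr !dotNr !dotNl; lra.
Qed.

Lemma diam_inv_ge u v : C u -> C v -> norm2 (W *m (u - v)) <= DSigma.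
Proof.
move=> Cu Cv; apply: ub_le_sup; first exact: has_ubound_diff.
by exists u => //; exists v.
Qed.

Lemma diam_inv_ge0 : 0 <= DSigma.
Proof. by have [u Cu] := C_nonempty; apply: le_trans (diam_inv_ge Cu Cu); exact: norm2_ge0. Qed.

Lemma variance_ge0 mu p : 0 <= dot p (covariance_mx (rho mu) *m p).
Proof.
have cp : continuous (dot p) by exact: continuous_dotl.
rewrite covariance_form.
have -> : Erho mu (fun u => dot p u * dot p u) - Erho mu (dot p) ^+ 2 =
    Erho mu (fun u => (dot p u - Erho mu (dot p)) ^+ 2) by rewrite ErhoB_sqr//; ring.
rewrite -[leLHS](Erho_cst mu); apply: le_Erho => [||u _]; last exact: sqr_ge0.
  exact: cst_continuous.
by continuity.
Qed.

(** The variance of b is at most its mean square distance to any constant. If the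
values of b on C lie in an interval of length w, the centre of an interval of
length w that ends at the maximum of b is within w / 2 of all of them. *)
Lemma popoviciu mu x :
  dot (W *m x) (covariance_mx (rho mu) *m (W *m x)) <= DSigma ^+ 2 / 4 * dot x x.
Proof.
set p := W *m x.
have cp : continuous (dot p) by exact: continuous_dotl.
have [v] := compact_EVT_max C_nonempty C_compact (continuous_subspaceT cp).
rewrite inE => Cv vmax.
pose w := norm2 x * DSigma.
have range_w u : C u -> dot p v - dot p u <= w.
  move=> Cu; rewrite -dotBr /p -[X in dot (X *m _) _]W_sym -dot_mulmx.
  apply: (le_trans (ler_norm _)); apply: (le_trans (cauchy_schwarz _ _)).
  by rewrite ler_wpM2l ?norm2_ge0// diam_inv_ge.
pose c := dot p v - w / 2.
have csq : continuous (fun u => (dot p u - c) ^+ 2) by continuity.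
have : Erho mu (fun u => (dot p u - c) ^+ 2) <= (w / 2) ^+ 2.
  rewrite -[leRHS](Erho_cst mu); apply: le_Erho => // [|u Cu]; first exact: cst_continuous.
  have := range_w u Cu; have : dot p u <= dot p v by apply: vmax; rewrite inE.
  rewrite /c => ? ?; rewrite -[leLHS]real_normK ?num_real// ler_sqr ?nnegrE//.
    by rewrite ler_norml; apply/andP; split; lra.
  by rewrite divr_ge0// mulr_ge0 ?norm2_ge0 ?diam_inv_ge0.
rewrite ErhoB_sqr// covariance_form.
have -> : (w / 2) ^+ 2 = DSigma ^+ 2 / 4 * dot x x.
  by rewrite -norm2_sqr /w; field.
by have := sqr_ge0 (Erho mu (dot p) - c); rewrite sqrrB; lra.
Qed.

(* Up to the factor tau, the Hessian of F in the coordinates where Sigma is I. *)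
Let hess mu := 1%:M - W *m covariance_mx (rho mu) *m W.

Let hess_form mu x : dot x (hess mu *m x) =
  dot x x - dot (W *m x) (covariance_mx (rho mu) *m (W *m x)).
Proof.
rewrite mulmxBl mul1mx dotBr -!mulmxA; congr (_ - _).
by rewrite [LHS]dot_mulmx W_sym.
Qed.

Let K := Num.max 1 (DSigma ^+ 2 / 4 - 1).
Let K_ge0 : 0 <= K. Proof. by rewrite le_max ler01. Qed.

Let hess_norm mu x : norm2 (hess mu *m x) <= K * norm2 x.
Proof.
apply: norm2_symm_le => // [|y].
  by rewrite /hess linearB/= trmx1 !trmx_mul covariance_sym W_sym mulmxA.
rewrite hess_form; have := popoviciu mu y; have := variance_ge0 mu (W *m y).
have := dot_ge0 y; have : 1 <= K by rewrite le_max lexx.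
have : DSigma ^+ 2 / 4 - 1 <= K by rewrite le_max lexx orbT.
by rewrite ler_norml => *; apply/andP; split; nra.
Qed.

Lemma smoothness_le : L <= Num.max 1 (DSigma ^+ 2 / 4 - 1).
Proof.
apply: ge_sup; first by exists (spectral_norm (hess 0)), 0.
by move=> _ [mu _ <-]; apply: spectral_norm_le => //; exact: hess_norm.
Qed.

(** This is the form of I - W Cov W at W h, since W (W h) = Sigma^-1 h. *)
Lemma smoothness_curvature mu h :
  dot h (invmx Sigma *m h) -
    dot (invmx Sigma *m h) (covariance_mx (rho mu) *m (invmx Sigma *m h)) <=
  L * dot h (invmx Sigma *m h).
Proof.
set p := invmx Sigma *m h; have Wh : W *m (W *m h) = p by rewrite mulmxA WW.
have hp : dot (W *m h) (W *m h) = dot h p by rewrite -[X in dot (X *m _)]W_sym -dot_mulmx Wh.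
rewrite -hp -Wh -hess_form.
apply: le_trans (spectral_norm_form _ (hess_norm mu) K_ge0) _.
rewrite ler_wpM2r ?dot_ge0//; apply: ub_le_sup; last by exists mu.
by exists K => _ [nu _ <-]; apply: spectral_norm_le => //; exact: hess_norm.
Qed.

(** If L < 1, the expectation of p^T u along the line spanned by h would grow at
rate at least (1 - L) h^T p > 0, although it is bounded by the values taken on
C. *)
Lemma smoothness_ge1 : (0 < m)%N -> 1 <= L.
Proof.
move=> m0; rewrite leNgt; apply/negP => L1.
pose h : 'cV[R]_m := const_mx 1; pose p := invmx Sigma *m h.
have H0 : 0 < dot h p.
  rewrite -sqnormE; apply: Sigma_inv_posdef.2.
  apply/eqP => /colP/(_ (Ordinal m0)); rewrite !mxE => /eqP.
  by rewrite oner_eq0.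
pose N t := Erho (t *: h) (dot p).
have dN t : is_derive t 1 (fun s => - N s) (- dot p (covariance_mx (rho (t *: h)) *m p)).
  have := mean_line_derive 0 h t; rewrite -/p /=.
  rewrite (_ : (fun s : R => _) = N); last first.
    by apply/funext => s; rewrite /N add0r; apply: eq_Erho => u _; rewrite subr0.
  by rewrite add0r; exact: is_deriveN.
have dN_le s : - dot p (covariance_mx (rho (s *: h)) *m p) <= (L - 1) * dot h p.
  by have := smoothness_curvature (s *: h) h; rewrite -/p; lra.
have cp : continuous (dot p) by exact: continuous_dotl.
have [A A0 pA] := continuous_bounded_on C_compact cp.
have N_le t : `|N t| <= A.
  rewrite ler_norml -[X in _ && (_ <= X)](Erho_cst (t *: h)).
  rewrite -[X in (X <= _) && _](Erho_cst (t *: h)).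
  by apply/andP; split; apply: le_Erho => //;
    do ?[exact: cst_continuous|move=> u /pA; rewrite ler_norml => /andP[]].
(* At this time the growth exceeds 2 A, the largest possible variation. *)
pose T := (2 * A + 1) / ((1 - L) * dot h p).
have T0 : 0 <= T by rewrite divr_ge0 ?mulr_ge0 ?subr_ge0 ?(ltW L1) ?(ltW H0)//; lra.
have NT := derive_le_growth dN dN_le T0; move: NT (N_le T) (N_le 0).
have -> : (L - 1) * dot h p * T = - (2 * A + 1).
  by rewrite /T; field; rewrite subr_eq0 !gt_eqF.
move: (N T) (N 0) => x y; rewrite !ler_norml => {}NT /andP[? ?] /andP[? ?].
by lra.
Qed.

(** Taylor's inequality on [0, 1] along h = mu' - mu. Here the expected slope at
mu is h^T Sigma^-1 h, so that the first-order term is - ||grad F||_P^2 and the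
second-order term is at most (L / 2) ||grad F||_P^2. *)
Lemma mppi_descent mu : let mu' := mean (rho mu) in
  F mu' <= F mu - (1 - L / 2) * sqnorm (tau^-1 *: Sigma) (gradient F mu).
Proof.
set mu' := mean _; rewrite /= gradient_sqnorm -/mu'; set h := mu' - mu.
set p := invmx Sigma *m h.
have dphi t := free_energy_line_derive mu h t; rewrite -/p in dphi.
have ddphi t : is_derive t 1
    (fun s => tau * (s * dot h p - Erho (mu + s *: h) (fun u => dot p (u - mu))))
    (tau * (dot h p - dot p (covariance_mx (rho (mu + t *: h)) *m p))).
  have dm := mean_line_derive mu h t; rewrite -/p /= in dm.
  apply: is_derive_eq; rewrite -![_ *: _]/(_ * _).
  ring.
have ddphi_le t : tau * (dot h p - dot p (covariance_mx (rho (mu + t *: h)) *m p)) <=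
    tau * (L * dot h p).
  by rewrite ler_pM2l//; exact: smoothness_curvature.
have := taylor2_le dphi ddphi ddphi_le.
rewrite scale1r scale0r addr0 mul0r sub0r Erho_dot_shift -/mu' -/h (dotC p h).
have -> : mu + h = mu' by rewrite /h addrC subrK.
clear ddphi_le ddphi dphi; move: (F mu') (F mu) L (dot h p) => a b l H ab.
by apply: (le_trans ab); rewrite le_eqVlt; apply/orP; left; apply/eqP; field.
Qed.

(** The Gaussian density is at most its normalizing constant, so Z is bounded. *)
Lemma free_energy_lbound : has_lbound (range F).
Proof.
have cf : continuous (fun u => expR (- f0 u / tau)) by continuity.
pose c := (Num.sqrt ((2 * pi) ^+ m * \det Sigma))^-1.
have c0 : 0 < c.
  rewrite invr_gt0 sqrtr_gt0 mulr_gt0 ?det_Sigma_gt0//.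
  by rewrite exprn_gt0// mulr_gt0// pi_gt0.
exists (- tau * ln (cint C (fun u => c * expR (- f0 u / tau)))) => _ [mu _ <-].
rewrite /free_energy ler_nM2l ?oppr_lt0// ler_ln ?posrE ?partition_fun_gt0//.
  apply: le_cint => //; [exact: continuous_gibbs|by continuity|move=> u _].
  rewrite /gaussian_pdf -/c ler_pM2r ?expR_gt0// ger_pMr// -expR0 ler_expR.
  rewrite oppr_le0 divr_ge0// sqnormE.
  exact: (posdef_psd Sigma_inv_posdef).2.
by apply: cint_gt0 => //; [by continuity|move=> u _; rewrite mulr_gt0 ?expR_gt0].
Qed.

(** |W x|^2 = x^T Sigma^-1 x <= |x|^2 / lambda_min: with y = Sigma^-1 x, expand
0 <= |x - lambda_min y|^2 and use lambda_min |y|^2 <= y^T Sigma y = y^T x. *)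
Lemma diam_inv_le : (0 < m)%N -> DSigma ^+ 2 <= diam C ^+ 2 / lambda_min Sigma.
Proof.
move=> m0; have [l0 lle] := lambda_minP m0 Sigma_posdef.
set l := lambda_min Sigma in l0 lle *.
have D_ge u v : C u -> C v -> norm2 (u - v) <= diam C.
  move=> Cu Cv; apply: ub_le_sup; last by exists u => //; exists v.
  have := has_ubound_diff 1%:M; congr has_ubound.
  by apply/seteqP; split=> y [a Ca [b Cb <-]]; exists a => //; exists b => //;
    rewrite mul1mx.
have D0 : 0 <= diam C.
  by have [u Cu] := C_nonempty; apply: le_trans (D_ge _ _ Cu Cu); exact: norm2_ge0.
have W_le x : norm2 (W *m x) ^+ 2 <= norm2 x ^+ 2 / l.
  rewrite !norm2_sqr -[X in dot (X *m _) _]W_sym -dot_mulmx mulmxA WW.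
  set y := invmx Sigma *m x.
  have xE : x = Sigma *m y by rewrite mulKVmx.
  have := lle y; rewrite -xE => ly.
  have := dot_ge0 (x - l *: y).
  rewrite dotBl !dotBr !dotZl !dotZr (dotC y x) => h0.
  rewrite ler_pdivlMr//; rewrite (dotC y x) in ly; nra.
have : DSigma <= Num.sqrt (diam C ^+ 2 / l).
  apply: ge_sup.
    by have [u Cu] := C_nonempty; exists (norm2 (W *m (u - u))), u => //; exists u.
  move=> _ [u Cu [v Cv <-]].
  rewrite -[leLHS]ger0_norm ?norm2_ge0// -sqrtr_sqr ler_wsqrtr//.
  apply: (le_trans (W_le _)); rewrite ler_pM2r ?invr_gt0//.
  by rewrite ler_sqr ?nnegrE ?norm2_ge0// D_ge.
rewrite -ler_sqr ?nnegrE ?sqrtr_ge0 ?diam_inv_ge0// sqr_sqrtr//.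
by rewrite divr_ge0 ?sqr_ge0 ?ltW.
Qed.

End mppi_theory.

(** * Convergence of the iteration *)

Unset Implicit Arguments.
Theorem mainTheorem4 (R : realType) (m : nat) (hm : (0 < m)%N)
    (C : set 'cV[R]_m) (f0 : 'cV[R]_m -> R) (tau : R) (Sigma : 'M[R]_m)
    (C_nonempty : C !=set0) (C_compact : compact C)
    (C_pos : (0 < lebesgue_cV m C)%E)
    (f0_continuous : continuous f0) (tau_gt0 : 0 < tau)
    (Sigma_posdef : posdef Sigma) :
  let pi_ := gaussian_pdf Sigma in
  let w := weight C f0 tau in
  let F := free_energy C f0 tau Sigma in
  let rho := tilted C f0 tau Sigma in
  let L := smoothness C f0 tau Sigma in
  let P := tau^-1 *: Sigma in
  let DSigma := diam_inv Sigma C in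
  let D := diam C in
  [/\ forall nu, mean (rho nu) =
        (\int[lebesgue_cV m]_u (pi_ nu u * w u))^-1 *:
          expect (pi_ nu) (fun u => w u *: u),
      (0 < (1 : R) < 2 / L) <-> (L < 2),
      forall mu : nat -> 'cV[R]_m,
        (forall k, mu k.+1 = mean (rho (mu k))) -> L < 2 ->
        [/\ forall k, F (mu k.+1) <=
              F (mu k) - (1 - L / 2) * sqnorm P (gradient F (mu k)),
            (\sum_(0 <= k <oo) (sqnorm P (gradient F (mu k)))%:E <=
              ((F (mu 0%N) - inf (range F)) / (1 - L / 2))%:E)%E,
            forall K : nat, (1 <= K)%N ->
              \big[Num.min/sqnorm P (gradient F (mu 0%N))]_(j < K)
                 sqnorm P (gradient F (mu j))
              <= (F (mu 0%N) - inf (range F)) / (K%:R * (1 - L / 2)) &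
            Num.sqrt (sqnorm P (gradient F (mu k))) @[k --> \oo] --> (0 : R)],
      L <= Num.max 1 (DSigma ^+ 2 / 4 - 1) /\ (DSigma ^+ 2 < 12 -> L < 2) &
      [/\ DSigma ^+ 2 <= D ^+ 2 / lambda_min Sigma,
          D ^+ 2 / 12 < lambda_min Sigma -> DSigma ^+ 2 < 12 &
          D ^+ 2 / 12 <= lambda_min Sigma -> DSigma ^+ 2 <= 12]].
Proof.
move=> pi_ w F rho L P DSigma D.
have L_ge1 : 1 <= L by exact: smoothness_ge1.
have L_gt0 : 0 < L by exact: lt_le_trans L_ge1.
have L_le : L <= Num.max 1 (DSigma ^+ 2 / 4 - 1) by exact: smoothness_le.
have [l_gt0 _] := lambda_minP hm Sigma_posdef.
have DD : DSigma ^+ 2 <= D ^+ 2 / lambda_min Sigma by exact: diam_inv_le.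
split.
- by move=> nu; exact: mppi_update.
- by rewrite ltr01 ltr_pdivlMr// mul1r.
- move=> mu muE L2.
  have c_gt0 : 0 < 1 - L / 2 by lra.
  have g_ge0 k : 0 <= sqnorm P (gradient F (mu k)).
    rewrite gradient_sqnorm// mulr_ge0 ?(ltW tau_gt0)//.
    exact: (posdef_psd (posdef_inv Sigma_posdef)).2.
  have F_ge k : inf (range F) <= F (mu k).
    by apply: ge_inf; [exact: free_energy_lbound|exists (mu k)].
  have F_decr k : F (mu k.+1) <= F (mu k) - (1 - L / 2) * sqnorm P (gradient F (mu k)).
    by rewrite muE; exact: mppi_descent.
  split=> //.
  + exact: (decrease_series c_gt0 g_ge0 F_ge F_decr).
  + by move=> K K1; exact: (decrease_min c_gt0 F_ge F_decr).
  + exact: (decrease_cvg0 c_gt0 g_ge0 F_ge F_decr).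
- split=> // D12; apply: (le_lt_trans L_le).
  by rewrite gt_max; apply/andP; split; lra.
- split=> //.
  + by rewrite ltr_pdivrMr// => h; apply: (le_lt_trans DD); rewrite ltr_pdivrMr// mulrC.
  + by rewrite ler_pdivrMr// => h; apply: (le_trans DD); rewrite ler_pdivrMr// mulrC.
Qed.
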